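(* Let $n\ge 2$, $m\ge 0$ and let $F\in\mathcal{E}'(\mathbf{S}^m)$. If $I^{m,k}F=0$ for $k=0,1,\dots,m$, then $F=0$.
   Context: Repeated indices are summed from $1$ to $n$. $\mathcal{E}'(S^p)$ denotes the space of symmetric $p$-tensor fields on $\mathbb{R}^n$ whose components are compactly supported distributions, and $\mathcal{E}'(\mathbf{S}^m)=\bigoplus_{p=0}^m\mathcal{E}'(S^p)$; an element is written $F=\sum_{p=0}^m f^{(p)}$ with $f^{(p)}=(f^{(p)}_{i_1\cdots i_p})\in\mathcal{E}'(S^p)$. For an integer $k\ge 0$ and $f\in\mathcal{E}'(S^p)$, the momentum ray transform $I^kf\in\mathcal{D}'(\mathbb{R}^n\times(\mathbb{R}^n\setminus\{0\}))$ is defined by $\langle I^kf,\psi\rangle=\langle f,(I^k)^*\psi\rangle$ for $\psi\in C_c^\infty(\mathbb{R}^n\times(\mathbb{R}^n\setminus\{0\}))$, where $[(I^k)^*\psi]_{i_1\cdots i_p}(x)=\int_{\mathbb{R}^n}\int_{\mathbb{R}}t^k\,\xi^{i_1}\cdots\xi^{i_p}\,\psi(x-t\xi,\xi)\,dt\,d\xi$ (the pairing of tensors sums over all indices). The generalized momentum ray transform is $I^{m,k}F=\sum_{p=0}^m I^kf^{(p)}$. For smooth compactly supported $F$ it is $I^{m,k}F(x,\xi)=\sum_{p=0}^m\int_{-\infty}^\infty t^k f^{(p)}_{i_1\cdots i_p}(x+t\xi)\,\xi^{i_1}\cdots\xi^{i_p}\,dt$. *)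

(* Defs.v *)
From HB Require Import structures.
From mathcomp Require Import all_boot all_order all_algebra all_fingroup.
From mathcomp Require Import all_classical all_reals all_analysis.
From mathcomp Require Import complex.

Set Implicit Arguments.
Unset Strict Implicit.
Unset Printing Implicit Defensive.

Import Order.TTheory GRing.Theory Num.Theory.
Import numFieldNormedType.Exports.

Local Open Scope classical_set_scope.
Local Open Scope complex_scope.
Local Open Scope ring_scope.

Section Smooth.
Context {R : realType} {V : normedModType R}.

(* [iter_deriv [:: v1; ...; vk] f] is D_v1 (... (D_vk f)). *)
Definition iter_deriv (vs : seq V) (f : V -> R) : V -> R :=
  foldr (fun v g x => 'D_v g x) f vs.

(* For V of finite dimension this is C^oo: all iterated directional derivatives
   of all orders exist and are continuous on the whole of V. *)
Definition smooth_real (f : V -> R) : Prop :=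
  forall vs : seq V,
    continuous (iter_deriv vs f) /\
    forall x v, derivable (iter_deriv vs f) x v.

Definition smooth (f : V -> R[i]) : Prop :=
  smooth_real (fun x => complex.Re (f x)) /\
  smooth_real (fun x => complex.Im (f x)).

End Smooth.

Section CompactlySupportedDistributions.
Context {R : realType} {n : nat}.

Definition partial (alpha : seq 'I_n) (phi : 'rV[R]_n -> R[i])
    (x : 'rV[R]_n) : R[i] :=
  let e := [seq delta_mx 0 j | j <- alpha] in
  iter_deriv e (fun y => complex.Re (phi y)) x +i*
  iter_deriv e (fun y => complex.Im (phi y)) x.

(* E'(R^n), as the dual of the Frechet space C^oo(R^n) of complex-valued smooth
   functions.  The underlying map is total on functions, but only its values on
   smooth functions are meaningful.  Continuity is the usual seminorm estimate
   |u(phi)| <= c * max_(|alpha| <= N) sup_K |d^alpha phi|, where M stands for an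
   arbitrary upper bound of the right-hand maximum. *)
Record cs_distribution := CsDistribution {
  dist_fun :> ('rV[R]_n -> R[i]) -> R[i];
  dist_linear : forall (a : R[i]) (phi psi : 'rV[R]_n -> R[i]),
    smooth phi -> smooth psi ->
    dist_fun (fun x => a * phi x + psi x) = a * dist_fun phi + dist_fun psi;
  dist_continuous : exists (K : set 'rV[R]_n) (N : nat) (c : R),
    compact K /\
    forall (phi : 'rV[R]_n -> R[i]) (M : R), smooth phi -> 0 <= M ->
      (forall alpha : seq 'I_n, (size alpha <= N)%N ->
         forall x, K x -> `|partial alpha phi x| <= M%:C) ->
      `|dist_fun phi| <= (c * M)%:C }.

(* The zero element of E'(R^n). *)
Definition dist_eq0 (u : cs_distribution) : Prop :=
  forall phi, smooth phi -> u phi = 0.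

(* E'(S^p): the component f_(i_1 ... i_p) is [tens_coef f i]. *)
Record sym_tensor (p : nat) := SymTensor {
  tens_coef :> p.-tuple 'I_n -> cs_distribution;
  tens_sym : forall (s : 'S_p) (i : p.-tuple 'I_n) phi, smooth phi ->
    tens_coef [tuple tnth i (s j) | j < p] phi = tens_coef i phi }.

(* E'(S^0) (+) ... (+) E'(S^m). *)
Definition sym_tensor_sum (m : nat) := forall p : 'I_m.+1, sym_tensor p.

Definition sym_tensor_sum_eq0 m (F : sym_tensor_sum m) : Prop :=
  forall (p : 'I_m.+1) (i : p.-tuple 'I_n), dist_eq0 (F p i).

End CompactlySupportedDistributions.

Arguments cs_distribution : clear implicits.
Arguments sym_tensor : clear implicits.
Arguments sym_tensor_sum : clear implicits.

Section Integral.
Context {R : realType}.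

Definition integral_R (f : R -> R[i]) : R[i] :=
  (\int[lebesgue_measure]_t complex.Re (f t)) +i*
  (\int[lebesgue_measure]_t complex.Im (f t)).

(* Lebesgue integral over R^n, as an iterated integral (Fubini); it is only
   applied to continuous functions with compact support. *)
Fixpoint integral_Rn (n : nat) : ('rV[R]_n -> R[i]) -> R[i] :=
  match n with
  | 0%N => fun f => f 0
  | n'.+1 => fun f =>
      integral_R (fun t => integral_Rn
        (fun v : 'rV[R]_n' => f (row_mx (t%:M : 'rV[R]_1) v)))
  end.

End Integral.

Section MomentumRayTransform.
Context {R : realType} {n : nat}.

(* C_c^oo(R^n x (R^n \ {0})); its elements are represented by their extension by
   zero to R^n x R^n. *)
Definition test_function (psi : 'rV[R]_n * 'rV[R]_n -> R[i]) : Prop :=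
  let supp := closure [set z | psi z != 0] in
  [/\ smooth psi, compact supp & supp `<=` [set z | z.2 != 0]].

(* The component i of (I^k)^* psi; it is a smooth function of x when psi is a
   test function, since psi is supported away from xi = 0. *)
Definition mrt_adjoint (k : nat) (p : nat) (i : p.-tuple 'I_n)
    (psi : 'rV[R]_n * 'rV[R]_n -> R[i]) (x : 'rV[R]_n) : R[i] :=
  integral_Rn (fun xi : 'rV[R]_n => integral_R (fun t : R =>
    (t ^+ k * \prod_(j < p) xi 0 (tnth i j))%:C * psi (x - t *: xi, xi))).

(* I^k f, as a functional on test functions. *)
Definition mrt (k p : nat) (f : sym_tensor R n p)
    (psi : 'rV[R]_n * 'rV[R]_n -> R[i]) : R[i] :=
  \sum_(i : p.-tuple 'I_n) f i (mrt_adjoint k i psi).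

(* I^{m,k} F. *)
Definition gmrt (m k : nat) (F : sym_tensor_sum R n m)
    (psi : 'rV[R]_n * 'rV[R]_n -> R[i]) : R[i] :=
  \sum_(p < m.+1) mrt k (F p) psi.

End MomentumRayTransform.

(* Main.v *)
From mathcomp Require Import all_boot all_order all_algebra all_fingroup.
From mathcomp Require Import all_classical all_reals all_analysis.
From mathcomp Require Import complex ring lra.
Require Import Defs.

(** The transform determines the tensor field for the following reason.

    For a family [U] of distributions indexed by finite sequences of indices and
    symmetric in them, let [I^k U] be the sum of the momentum ray transforms of its
    components.  If [e] is the [j]-th basis vector, then

      [d_(xi_j) (I^k U) - d_(x_j) (I^(k+1) U) = I^k U'],

    where [U'_s = (|s| + 1) U_(j :: s)] is the contraction of [U] with [e]: on the
    integrand [t^k xi^i f_i (x + t xi)] the two derivatives that fall on [f] cancel,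
    and only the derivative of the monomial [xi^i] survives.  Vanishing of the
    moments [0, ..., m] therefore passes to the moments [0, ..., m - 1] of all
    contractions, and by induction on [m] all components of positive rank vanish
    ([tensor_injectivity]).  On test functions the identity is an integration by
    parts in [xi] ([ray_adjoint_by_parts]) followed by Euler's relation for
    symmetric forms ([symmetric_derivative_sum]).

    There remains a scalar distribution [u] with [I^0 u = 0].  Testing against
    [a(x) tau(xi)^k], where [tau] peaks at a direction [xi0], and letting [k] grow,
    one finds that [u] annihilates the averages of [a] over the lines parallel to
    [xi0] ([ray_average_annihilated]).  Hence [u] annihilates all smooth functions
    that are invariant along some direction ([ray_invariant_annihilated]).  Among
    them are the products [(x_i + l x_j)^d g], with [g] independent of [x_i] and
    [x_j]; being polynomial in [l], this yields [x_i^a x_j^b g]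
    ([monomial_annihilated]).  It is here that the dimension must be at least [2].
    Landau's proof of the Weierstrass theorem, carried out in one variable at a time
    and with all derivatives, shows that such functions are dense
    ([coord_density]), so that [u = 0] ([scalar_injectivity]).  No Fourier
    transform enters.

    Two tools carry the analysis.  Iterated Lebesgue integrals are handled as
    positive functionals on compactly supported continuous functions ([radon]), for
    which differentiation under the integral sign follows from the mean value
    theorem and compactness ([radon_param_smooth_along]).  Both limits above, the
    localization at a direction and the Landau kernels, are instances of one fact:
    the powers of a function with a unique maximum concentrate at that maximum
    ([real_dist_concentration]). *)

Set Implicit Arguments.
Unset Strict Implicit.
Unset Printing Implicit Defensive.

Import Order.TTheory GRing.Theory Num.Theory.
Import numFieldNormedType.Exports.

Local Open Scope classical_set_scope.
Local Open Scope ring_scope.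

(** * Functions smooth along a set of directions *)

Section SmoothAlong.
Context {R : realType}.
Implicit Types U V : normedModType R.

(** The set [D] of admissible directions lets one calculus serve both functions
    that are smooth in all variables and integrands that are smooth only in the
    parameter on which an integral depends. *)
Record smooth_along V (D : V -> Prop) (f : V -> R) : Prop := SmoothAlong {
  smooth_alongP : forall vs : seq V, (forall v, v \in vs -> D v) ->
    continuous (iter_deriv vs f) /\
    forall x v, D v -> derivable (iter_deriv vs f) x v }.

Lemma smooth_realE V (f : V -> R) :
  smooth_real f <-> smooth_along (fun=> True) f.
Proof.
split=> [sf|[sf] vs]; first by split=> vs _; have [? df] := sf vs; split=> // x v _.
by have [|cf df] := sf vs; split=> // x v; exact: df.
Qed.

Lemma iter_deriv_rcons V (vs : seq V) v (f : V -> R) :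
  iter_deriv (rcons vs v) f = iter_deriv vs (fun x => 'D_v f x).
Proof. by rewrite /iter_deriv foldr_rcons. Qed.

Lemma smooth_along_continuous V D (f : V -> R) : smooth_along D f -> continuous f.
Proof. by case=> /(_ [::]) []. Qed.

Lemma smooth_along_derivable V D (f : V -> R) x v :
  D v -> smooth_along D f -> derivable f x v.
Proof. by move=> Dv [/(_ [::])[//|_ /(_ x v Dv)]]. Qed.

Lemma smooth_along_derive V D (f : V -> R) v :
  D v -> smooth_along D f -> smooth_along D ('D_v f).
Proof.
move=> Dv [sf]; split=> vs Dvs; rewrite -iter_deriv_rcons; apply: sf => w.
by rewrite mem_rcons inE => /predU1P[->//|]; exact: Dvs.
Qed.

Lemma smooth_along_sub V (D D' : V -> Prop) (f : V -> R) :
  (forall v, D v -> D' v) -> smooth_along D' f -> smooth_along D f.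
Proof.
move=> DD' [sf]; split=> vs Dvs; have [|cf df] := sf vs; first by move=> v /Dvs /DD'.
by split=> // x v /DD'; exact: df.
Qed.

(** The coinduction principle behind every closure property below: it replaces
    formulas for iterated derivatives by a class of functions that is stable
    under one differentiation. *)
Lemma smooth_along_coind V D (C : (V -> R) -> Prop) (f : V -> R) :
  (forall g, C g -> continuous g /\
     forall v, D v -> (forall x, derivable g x v) /\ C ('D_v g)) ->
  C f -> smooth_along D f.
Proof.
move=> hC Cf; split=> vs Dvs; suff /hC[? dg] : C (iter_deriv vs f).
  by split=> // x v Dv; case: (dg v Dv).
elim: vs Dvs => [//|v vs IH] Dvs /=.
have /hC[_ dg] := IH (fun w hw => Dvs w (mem_behead (s := v :: vs) hw)).
by have [|//] := dg v; apply: Dvs; rewrite mem_head.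
Qed.

Lemma smooth_along_cst V (D : V -> Prop) (c : R) : smooth_along D (fun=> c).
Proof.
apply: (@smooth_along_coind V D (fun g => exists c, g = fun=> c)); last by exists c.
move=> _ [d ->]; split=> [x|v _]; first exact: cst_continuous.
split=> [x|]; first exact: derivable_cst.
by exists 0; apply/funext => x; rewrite derive_cst.
Qed.

Lemma smooth_alongD V D (f g : V -> R) : smooth_along D f -> smooth_along D g ->
  smooth_along D (fun x => f x + g x).
Proof.
move=> sf sg; apply: (@smooth_along_coind V D (fun h => exists f g,
  [/\ smooth_along D f, smooth_along D g & h = f + g])); last by exists f, g.
move=> _ [{sf}f [{sg}g [sf sg ->]]]; split=> [x|v Dv].
  by apply: continuousD; [exact: (smooth_along_continuous sf)|
    exact: (smooth_along_continuous sg)].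
have df x : derivable f x v by exact: smooth_along_derivable sf.
have dg x : derivable g x v by exact: smooth_along_derivable sg.
split=> [x|]; first exact: derivableD.
exists ('D_v f), ('D_v g); split; [exact: smooth_along_derive..|].
by apply/funext => x; rewrite deriveD.
Qed.

(** The finite sums of products of smooth functions, a class which the product
    rule keeps stable under differentiation. *)
Inductive sums_of_products V (D : V -> Prop) : (V -> R) -> Prop :=
| SumsM f g of smooth_along D f & smooth_along D g : sums_of_products D (f * g)
| SumsD h k of sums_of_products D h & sums_of_products D k :
    sums_of_products D (h + k).

Lemma smooth_alongM V D (f g : V -> R) : smooth_along D f -> smooth_along D g ->
  smooth_along D (fun x => f x * g x).
Proof.
move=> sf sg; apply: (@smooth_along_coind V D (sums_of_products D)); last exact: SumsM.
move=> p; elim=> {f g sf sg p} [f g sf sg|h k _ [ch dh] _ [ck dk]].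
- split=> [x|v Dv].
    have cf := smooth_along_continuous sf; have cg := smooth_along_continuous sg.
    by apply: continuousM; [exact: cf|exact: cg].
  have df x : derivable f x v by exact: smooth_along_derivable sf.
  have dg x : derivable g x v by exact: smooth_along_derivable sg.
  split=> [x|]; first exact: derivableM.
  have -> : 'D_v (f * g) = f * 'D_v g + g * 'D_v f.
    by apply/funext => x; rewrite deriveM.
  by apply: SumsD; apply: SumsM => //; exact: smooth_along_derive.
- split=> [x|v Dv]; first by apply: continuousD; [exact: ch|exact: ck].
  have [{}dh Dh] := dh v Dv; have [{}dk Dk] := dk v Dv.
  split=> [x|]; first exact: derivableD.
  have -> : 'D_v (h + k) = 'D_v h + 'D_v k by apply/funext => x; rewrite deriveD.
  exact: SumsD.
Qed.

Lemma smooth_alongZ V D c (f : V -> R) : smooth_along D f ->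
  smooth_along D (fun x => c * f x).
Proof. by move=> sf; apply: smooth_alongM => //; exact: smooth_along_cst. Qed.

Lemma smooth_alongB V D (f g : V -> R) : smooth_along D f -> smooth_along D g ->
  smooth_along D (fun x => f x - g x).
Proof.
move=> sf sg; apply: smooth_alongD => //.
by under eq_fun do rewrite -mulN1r; exact: smooth_alongZ.
Qed.

Lemma smooth_along_sum V D I (s : seq I) (F : I -> V -> R) :
  (forall i, smooth_along D (F i)) -> smooth_along D (fun x => \sum_(i <- s) F i x).
Proof.
move=> sF; elim: s => [|i s IH].
  by under eq_fun do rewrite big_nil; exact: smooth_along_cst.
by under eq_fun do rewrite big_cons; exact: smooth_alongD.
Qed.

Lemma smooth_along_prod V D I (s : seq I) (F : I -> V -> R) :
  (forall i, smooth_along D (F i)) -> smooth_along D (fun x => \prod_(i <- s) F i x).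
Proof.
move=> sF; elim: s => [|i s IH].
  by under eq_fun do rewrite big_nil; exact: smooth_along_cst.
by under eq_fun do rewrite big_cons; exact: smooth_alongM.
Qed.

Lemma smooth_alongX V D k (f : V -> R) : smooth_along D f ->
  smooth_along D (fun x => f x ^+ k).
Proof.
move=> sf; elim: k => [|k IH]; first exact: smooth_along_cst.
by under eq_fun do rewrite exprS; exact: smooth_alongM.
Qed.

Definition affine_along U V (phi : U -> V) (u : U) (v : V) :=
  forall x (t : R), phi (t *: u + x) = t *: v + phi x.

Lemma derivable_comp_affine U V (phi : U -> V) u v (f : V -> R) x :
  affine_along phi u v -> derivable f (phi x) v -> derivable (f \o phi) x u.
Proof.
move=> phiE; rewrite /derivable; set F := fun _ => _; set G := fun _ => _.
by rewrite (_ : G = F)//; apply/funext => t; rewrite /F/G /= /shift/= phiE.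
Qed.

Lemma derive_comp_affine U V (phi : U -> V) u v (f : V -> R) x :
  affine_along phi u v -> 'D_u (f \o phi) x = 'D_v f (phi x).
Proof.
move=> phiE; rewrite /derive; congr lim; set F := fun _ => _; set G := fun _ => _.
by rewrite (_ : G = F)//; apply/funext => t; rewrite /F/G /= /shift/= phiE.
Qed.

(** The inner map need not be affine: it suffices that it is affine along each
    line in an admissible direction, with a velocity that is constant in space.
    The shear [(x, xi, t) |-> x - t xi] has this property in the directions of
    [x], although it is quadratic. *)
Lemma smooth_along_comp U V (D : U -> Prop) (D' : V -> Prop) (phi : U -> V)
    (L : U -> V) (f : V -> R) :
  continuous phi -> (forall u, D u -> D' (L u) /\ affine_along phi u (L u)) ->
  smooth_along D' f -> smooth_along D (f \o phi).
Proof.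
move=> cphi hL sf; apply: (@smooth_along_coind U D (fun h => exists2 f,
  smooth_along D' f & h = f \o phi)); last by exists f.
move=> _ [{sf}f sf ->]; split=> [x|u /hL[D'u uL]].
  by apply: continuous_comp; [exact: cphi|exact: (smooth_along_continuous sf)].
split=> [x|]; first by apply: derivable_comp_affine uL _; exact: smooth_along_derivable sf.
exists ('D_(L u) f); first exact: smooth_along_derive.
by apply/funext => x; exact: derive_comp_affine.
Qed.

(** Functions that are merely continuous in the inadmissible directions enter as
    weights. *)
Lemma smooth_along_inv V (D : V -> Prop) (f : V -> R) : continuous f ->
  (forall v, D v -> forall x t, f (t *: v + x) = f x) -> smooth_along D f.
Proof.
move=> cf finv.
apply: (@smooth_along_coind V D (fun h => h = f \/ h = fun=> 0)); last by left.
move=> _ [->|->]; split=> //.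
- move=> v Dv; have -> : 'D_v f = fun=> 0.
    apply/funext => x; rewrite -(derive_cst (f x) x v) /derive; congr lim.
    set F := fun _ => _; set G := fun _ => _.
    by rewrite (_ : G = F)//; apply/funext=> t; rewrite /F/G/= /shift/= finv.
  split; last by right.
  move=> x; have := derivable_cst (f x) x v; rewrite /derivable.
  set F := fun _ => _; set G := fun _ => _.
  by rewrite (_ : G = F)//; apply/funext=> t; rewrite /F/G/= /shift/= finv.
- by move=> x; exact: cst_continuous.
- move=> v Dv; split=> [x|]; first exact: derivable_cst.
  by right; apply/funext=> x; rewrite derive_cst.
Qed.

Lemma near_eq_iter_deriv V (f g : V -> R) vs (x : V) :
  (\forall y \near nbhs x, f y = g y) ->
  \forall y \near nbhs x, iter_deriv vs f y = iter_deriv vs g y.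
Proof.
move=> fg; elim: vs => [//|v vs IH] /=.
have := nbhs_interior IH; apply: filterS => y /= fgy.
exact: near_eq_derive.
Qed.

Lemma line_mean_value V (f : V -> R) (v x : V) (h : R) :
  (forall y, derivable f y v) ->
  exists2 s, `|s| <= `|h| & f (h *: v + x) - f x = h * 'D_v f (s *: v + x).
Proof.
move=> df; pose g t := f (t *: v + x).
have aff : affine_along (fun t : R => t *: v + x) 1 v.
  by move=> y t; rewrite scalerDl addrA [_%:A]mulr1.
have dg (t : R) : is_derive t (1 : R) g ('D_v f (t *: v + x)).
  rewrite -(derive_comp_affine f _ aff); apply: derivableP.
  exact: derivable_comp_affine aff _.
have cg : continuous g.
  by move=> t; apply: differentiable_continuous; apply/derivable1_diffP; case: (dg t).
have hsub a b : {within `[a, b], continuous g} by apply: continuous_subspaceT.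
have g0 : g 0 = f x by rewrite /g scale0r add0r.
have [h0|h0] := leP 0 h.
  have [c] := MVT_segment h0 (fun t _ => dg t) (hsub _ _).
  rewrite in_itv/= => /andP[c0 ch] E; exists c; first by rewrite !ger0_norm.
  by rewrite -/(g h) -g0 E subr0 mulrC.
have [c] := MVT_segment (ltW h0) (fun t _ => dg t) (hsub _ _).
rewrite in_itv/= => /andP[hc c0] E; exists c; first by rewrite !ler0_norm ?lerN2// ltW.
by rewrite -/(g h) -g0 -opprB E sub0r mulrN opprK mulrC.
Qed.

Lemma derive_dirZ V (f : V -> R) a v x : derivable f x v ->
  'D_(a *: v) f x = a * 'D_v f x.
Proof.
move=> df; pose phi (t : R) := t *: v + x.
have aff b : affine_along phi b (b *: v).
  by move=> y t; rewrite /phi scalerDl addrA scalerA.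
have phi0 : phi 0 = x by rewrite /phi scale0r add0r.
have dg : differentiable (f \o phi) 0.
  apply/derivable1_diffP; apply: derivable_comp_affine (aff 1) _.
  by rewrite phi0 scale1r.
have dirE b : 'D_(b *: v) f x = 'D_b (f \o phi) 0.
  by rewrite (derive_comp_affine f 0 (aff b)) phi0.
have -> : 'D_v f x = 'D_(1 *: v) f x by rewrite scale1r.
by rewrite !dirE !deriveE// -[a in LHS]mulr1 linearZ.
Qed.

(** For directional derivatives additivity in the direction is not formal: the
    second increment starts at the moving point [h v + x], and the mean value
    theorem compares it with [D_w f x] through the continuity of [D_w f]. *)
Lemma derive_dirD V (f : V -> R) v w x :
  derivable f x v -> (forall y, derivable f y w) -> {for x, continuous ('D_w f)} ->
  'D_(v + w) f x = 'D_v f x + 'D_w f x.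
Proof.
move=> dv dw cw; apply: cvg_lim => //=.
have hv : h^-1 * (f (h *: v + x) - f x) @[h --> 0^'] --> 'D_v f x by exact: dv.
suff hw : h^-1 * (f (h *: w + (h *: v + x)) - f (h *: v + x)) @[h --> 0^'] --> 'D_w f x.
  apply: cvg_trans (cvgD hv hw); apply: near_eq_cvg; near=> h.
  have -> : h *: (v + w) + x = h *: w + (h *: v + x).
    by rewrite scalerDr -addrA addrCA.
  rewrite [LHS]/GRing.add/= -mulrDr; congr (_ * _).
  by rewrite addrC addrA subrK.
apply/cvgrPdist_lt => e e0.
have [d /= d0 hd] : nbhs_ball x [set y | `|'D_w f x - 'D_w f y| < e].
  by move/cvgrPdist_lt : cw => /(_ e e0) /nbhs_ballP.
have N0 : 0 < `|v| + `|w| + 1 by rewrite ltr_wpDl// addr_ge0.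
near=> h.
have h0 : h != 0 by near: h; exact: nbhs_dnbhs_neq.
have [s sh ->] := line_mean_value (h *: v + x) h dw.
rewrite mulKf//; apply: hd; rewrite -ball_normE/= addrA opprD addrCA subrr addr0 normrN.
rewrite (le_lt_trans (ler_normD _ _))// !normrZ.
apply: (@le_lt_trans _ _ (`|h| * (`|v| + `|w| + 1))).
  rewrite -addrA mulrDr [X in _ <= X]addrC lerD// -?addrA ?ler_wpM2l ?lerDl//.
  by apply: (le_trans (ler_wpM2r _ sh)) => //; rewrite ler_wpM2l ?lerDl//.
rewrite -ltr_pdivlMr//; near: h; apply: dnbhs0_lt.
by rewrite divr_gt0.
Unshelve. all: by end_near. Qed.

End SmoothAlong.

(** * Radon functionals and integrals depending on a parameter *)

Section RadonFunctionals.
Context {R : realType}.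
Implicit Types V W : normedModType R.

Definition vanish_off W (K : set W) (f : W -> R) := forall w, ~ K w -> f w = 0.

Record Cc W (f : W -> R) : Prop := MkCc {
  Cc_continuous : continuous f;
  Cc_support : exists2 K, compact K & vanish_off K f }.

(** The three properties of integration that the arguments below use.  They are
    inherited by iterated integrals, so that no product measure is needed; the
    strict positivity replaces every explicit lower bound of an integral. *)
Record radon W (J : (W -> R) -> R) : Prop := Radon {
  radon_linear : forall a f g, Cc f -> Cc g ->
    J (fun w => a * f w + g w) = a * J f + J g;
  radon_bound : forall K, compact K -> exists2 C, 0 <= C &
    forall f M, continuous f -> vanish_off K f -> (forall w, `|f w| <= M) ->
    `|J f| <= C * M;
  radon_gt0 : forall f, Cc f -> (forall w, 0 <= f w) ->
    forall w, 0 < f w -> 0 < J f }.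

Lemma Cc0 W : Cc (fun _ : W => 0 : R).
Proof.
split; first by move=> ?; exact: cst_continuous.
by exists set0; [exact: compact0|].
Qed.

Lemma CcZ_D W a (f g : W -> R) : Cc f -> Cc g -> Cc (fun w => a * f w + g w).
Proof.
move=> [cf [K cK Kf]] [cg [L cL Lg]]; split.
  move=> w; apply: (@cvgD _ _ _ _ _ (fun w => a * f w) g); last exact: cg.
  by apply: cvgMr; exact: cf.
exists (K `|` L); first exact: compactU.
by move=> w /not_orP[nK nL]; rewrite Kf// Lg// mulr0 addr0.
Qed.

Lemma CcD W (f g : W -> R) : Cc f -> Cc g -> Cc (fun w => f w + g w).
Proof. by move=> cf cg; have := CcZ_D 1 cf cg; under eq_fun do rewrite mul1r. Qed.

Lemma CcM W (f g : W -> R) : continuous f -> Cc g -> Cc (fun w => f w * g w).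
Proof.
move=> cf [cg [K cK Kg]]; split.
  by move=> w; apply: (@cvgM _ _ _ _ f g); [exact: cf|exact: cg].
by exists K => // w nK; rewrite Kg// mulr0.
Qed.

Lemma CcZ W a (f : W -> R) : Cc f -> Cc (fun w => a * f w).
Proof. by apply: CcM => ?; exact: cst_continuous. Qed.

Lemma CcB W (f g : W -> R) : Cc f -> Cc g -> Cc (fun w => f w - g w).
Proof.
by move=> cf cg; have := CcZ_D (-1) cg cf; under eq_fun do rewrite mulN1r addrC.
Qed.

Section Linear.
Context {W : normedModType R} {J : (W -> R) -> R} (rJ : radon J).

Lemma radon0 : J (fun=> 0) = 0.
Proof.
have := radon_linear rJ 1 (Cc0 W) (Cc0 W).
under eq_fun do rewrite mulr0 addr0; lra.
Qed.

Lemma radonZ a f : Cc f -> J (fun w => a * f w) = a * J f.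
Proof.
move=> cf; have := radon_linear rJ a cf (Cc0 W).
by under eq_fun do rewrite addr0; rewrite radon0 addr0.
Qed.

Lemma radonD f g : Cc f -> Cc g -> J (fun w => f w + g w) = J f + J g.
Proof.
move=> cf cg; have := radon_linear rJ 1 cf cg.
by under eq_fun do rewrite mul1r; rewrite mul1r.
Qed.

Lemma radonB f g : Cc f -> Cc g -> J (fun w => f w - g w) = J f - J g.
Proof.
move=> cf cg; have := radon_linear rJ (-1) cg cf.
under eq_fun do rewrite mulN1r addrC; rewrite mulN1r => ->; by rewrite addrC.
Qed.

Lemma radon_sum I (s : seq I) (F : I -> W -> R) : (forall i, Cc (F i)) ->
  J (fun w => \sum_(i <- s) F i w) = \sum_(i <- s) J (F i).
Proof.
move=> cF; suff [] : Cc (fun w => \sum_(i <- s) F i w) /\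
  J (fun w => \sum_(i <- s) F i w) = \sum_(i <- s) J (F i) by [].
elim: s => [|i s [IH1 IH2]].
  under eq_fun do rewrite big_nil; rewrite big_nil radon0; split=> //; exact: Cc0.
under eq_fun do rewrite big_cons; rewrite big_cons -IH2; split.
  exact: CcD.
exact: radonD.
Qed.

Lemma radon_ge0 f : Cc f -> (forall w, 0 <= f w) -> 0 <= J f.
Proof.
move=> cf f0; have [[w fw]|nf] := pselect (exists w, f w != 0).
  by apply/ltW/(radon_gt0 rJ cf f0 (w := w)); rewrite lt_neqAle eq_sym fw f0.
suff -> : f = fun=> 0 by rewrite radon0.
by apply/funext => w; apply/eqP/negP => /negP fw; apply: nf; exists w.
Qed.

Lemma radon_le f g : Cc f -> Cc g -> (forall w, f w <= g w) -> J f <= J g.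
Proof.
move=> cf cg fg; rewrite -subr_ge0 -radonB//; apply: radon_ge0.
  exact: CcB.
by move=> w; rewrite subr_ge0.
Qed.

End Linear.

(** Local uniformity of the support is what allows continuity and derivatives
    to pass through the functional applied to the second variable. *)
Definition fiber_Cc V W (h : V * W -> R) := forall x0 : V,
  exists2 K : set W, compact K &
  \forall x \near nbhs x0, vanish_off K (fun w => h (x, w)).

Lemma continuous_pairr V W (x : V) : continuous (fun w : W => (x, w)).
Proof. by move=> w; apply: cvg_pair => //=; exact: cvg_cst. Qed.

Lemma continuous_pairl V W (w : W) : continuous (fun x : V => (x, w)).
Proof. by move=> x; apply: cvg_pair => //=; exact: cvg_cst. Qed.

Lemma fiber_Cc_Cc V W (h : V * W -> R) x : continuous h -> fiber_Cc h ->
  Cc (fun w => h (x, w)).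
Proof.
move=> ch /(_ x)[K cK Kh]; split; last by exists K => //; exact: nbhs_singleton Kh.
by move=> w; apply: (continuous_comp (f := fun w => (x, w)) (g := h));
  [exact: continuous_pairr|exact: ch].
Qed.

(** Continuity at the points of a compact fibre is uniform near the fibre. *)
Lemma tube_near V W (h : V * W -> R) (K : set W) x0 e :
  continuous h -> compact K -> 0 < e ->
  \forall x \near nbhs x0, forall w, K w -> `|h (x0, w) - h (x, w)| < e.
Proof.
move=> ch /compact_near_coveringP cK e0.
apply: (cK _ (nbhs x0) (fun x w => `|h (x0, w) - h (x, w)| < e)) => w Kw.
have /cvgrPdist_lt/(_ (e / 2)) := ch (x0, w); rewrite divr_gt0// => /(_ isT).
case=> -[A B] /= [Ax Bw] AB; exists (B, A) => //= -[w' x] /= [Bw' Ax'].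
have hx0 := AB (x0, w') (conj (nbhs_singleton Ax) Bw').
have hx := AB (x, w') (conj Ax' Bw').
rewrite /= in hx0 hx.
rewrite (splitr e); apply: le_lt_trans (ltrD hx0 hx).
by rewrite [X in _ <= X + _]distrC; apply: ler_distD.
Qed.

Section Parametric.
Context {V W : normedModType R} {J : (W -> R) -> R} (rJ : radon J).
Implicit Type h : V * W -> R.

Lemma radon_param_continuous h : continuous h -> fiber_Cc h ->
  continuous (fun x => J (fun w => h (x, w))).
Proof.
move=> ch fh x0; apply/cvgrPdist_le => e e0.
have [K cK Kh] := fh x0; have Kh0 := nbhs_singleton Kh.
have [C C0 JC] := radon_bound rJ cK.
have e'0 : 0 < e / (C + 1) by rewrite divr_gt0// ltr_wpDl.
have := tube_near x0 ch cK e'0; move: Kh; apply: filterS2 => x Kh hx.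
have cx y : Cc (fun w => h (y, w)) by exact: fiber_Cc_Cc.
rewrite -(radonB rJ)//; apply: le_trans (JC _ (e / (C + 1)) _ _ _) _.
- move=> w; apply: (@cvgB _ _ _ _ _ (fun w => h (x0, w)) (fun w => h (x, w)));
    exact: Cc_continuous.
- by move=> w nKw; rewrite Kh// Kh0// subr0.
- move=> w; have [Kw|nKw] := pselect (K w); first exact/ltW/hx.
  by rewrite Kh// Kh0// subr0 normr0 ltW.
- by rewrite mulrA ler_pdivrMr ?ltr_wpDl// mulrC ler_pM2l// lerDl.
Qed.

Let direction v : V * W := (v, 0).

Lemma derive_direction h x w v :
  'D_(v, 0) h (x, w) = 'D_v (fun y => h (y, w)) x.
Proof.
rewrite -(@derive_comp_affine _ _ _ (fun y => (y, w)) v)// => y t.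
by congr pair; rewrite /= scaler0 add0r.
Qed.

Lemma derivable_direction h x w v :
  derivable (fun y => h (y, w)) x v -> derivable h (x, w) (v, 0).
Proof.
rewrite /derivable; set F := fun _ => _; set G := fun _ => _.
suff -> : F = G by [].
apply/funext => s; rewrite /F /G /= /shift/=; congr (_ *: (h _ - _)).
by congr pair; rewrite /= scaler0 add0r.
Qed.

Lemma fiber_Cc_derive h v : fiber_Cc h -> fiber_Cc ('D_(v, 0) h).
Proof.
move=> fh x0; have [K cK Kh] := fh x0; exists K => //.
have := nbhs_interior Kh; apply: filterS => x Khx w nKw.
rewrite derive_direction -[RHS](derive_cst (0 : R) x v); apply: near_eq_derive.
by move: Khx; apply: filterS => y; exact.
Qed.

(** By the mean value theorem the difference quotients of [h] in the parameter
    are values of [D_v h] at nearby points, which converge uniformly on the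
    compact set that carries the integrands. *)
Lemma is_derive_radon_param h v x0 : continuous h -> fiber_Cc h ->
  (forall z, derivable h z (v, 0)) -> continuous ('D_(v, 0) h) ->
  is_derive x0 v (fun x => J (fun w => h (x, w)))
    (J (fun w => 'D_(v, 0) h (x0, w))).
Proof.
move=> ch fh dh cD; set D := 'D_(v, 0) h.
have fD : fiber_Cc D by exact: fiber_Cc_derive.
have ch' x : Cc (fun w => h (x, w)) by exact: fiber_Cc_Cc.
have cD' x : Cc (fun w => D (x, w)) by exact: fiber_Cc_Cc.
have pair_dir (s : R) w : s *: direction v + (x0, w) = (s *: v + x0, w).
  by congr pair; rewrite /= scaler0 add0r.
suff lim : s^-1 *: (J (fun w => h (s *: v + x0, w)) - J (fun w => h (x0, w)))
    @[s --> 0^'] --> J (fun w => D (x0, w)).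
  by split; [apply/cvg_ex; exists (J (fun w => D (x0, w)))|exact: cvg_lim].
apply/cvgrPdist_le => e e0.
have [K cK Kh] := fh x0; have [L cL LD] := fD x0.
have cKL := compactU cK cL; have [C C0 JC] := radon_bound rJ cKL.
have e'0 : 0 < e / (C + 1) by rewrite divr_gt0// ltr_wpDl.
have [d /= d0 dP] : nbhs_ball x0 [set x | vanish_off K (fun w => h (x, w)) /\
    forall w, (K `|` L) w -> `|D (x0, w) - D (x, w)| < e / (C + 1)].
  by apply/nbhs_ballP/filterI => //; exact: tube_near.
have {dP} dP x : `|x - x0| < d -> vanish_off K (fun w => h (x, w)) /\
    forall w, (K `|` L) w -> `|D (x0, w) - D (x, w)| < e / (C + 1).
  by move=> hx; apply: dP; rewrite -ball_normE /= distrC.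
near=> s.
have s0 : s != 0 by near: s; exact: nbhs_dnbhs_neq.
have sd : `|s| * (`|v| + 1) < d.
  rewrite -ltr_pdivlMr ?ltr_wpDl//; near: s; apply: dnbhs0_lt.
  by rewrite divr_gt0// ltr_wpDl.
have sP t : `|t| <= `|s| -> `|t *: v + x0 - x0| < d.
  move=> ts; rewrite addrK normrZ; apply: le_lt_trans sd.
  by apply: ler_pM; rewrite ?lerDl.
have cdiff := CcB (ch' (s *: v + x0)) (ch' x0).
rewrite -(radonB rJ)// -[_ *: _](radonZ rJ)// -(radonB rJ)//; last exact: CcZ.
have [hK0 _] : vanish_off K (fun w => h (x0, w)) /\
    forall w, (K `|` L) w -> `|D (x0, w) - D (x0, w)| < e / (C + 1).
  by apply: dP; rewrite subrr normr0.
apply: le_trans (JC _ (e / (C + 1)) _ _ _) _.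
- exact: Cc_continuous (CcB (cD' x0) (CcZ s^-1 cdiff)).
- move=> w /not_orP[nK nL]; rewrite (nbhs_singleton LD w nL).
  by rewrite hK0// (dP _ (sP s (lexx _))).1// subrr mulr0 subrr.
- move=> w; have [KLw|/not_orP[nK nL]] := pselect ((K `|` L) w).
    rewrite -(pair_dir s); have [t ts ->] := line_mean_value (x0, w) s (fun z => dh z).
    by rewrite mulKf// (pair_dir t) ltW// (dP _ (sP t ts)).2.
  rewrite (nbhs_singleton LD w nL) hK0// (dP _ (sP s (lexx _))).1//.
  by rewrite subrr mulr0 subrr normr0 ltW.
- by rewrite mulrA ler_pdivrMr ?ltr_wpDl// mulrC ler_pM2l// lerDl.
Unshelve. all: by end_near. Qed.

Definition along1 (z : V * W) := z.2 = 0.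

(** Differentiation under the integral sign, for all derivatives at once: the
    functions of the form [x |-> J (h (x, _))] are stable under [D_v]. *)
Lemma radon_param_smooth_along (D : V -> Prop) h :
  smooth_along (fun z : V * W => D z.1 /\ z.2 = 0) h -> fiber_Cc h ->
  smooth_along D (fun x => J (fun w => h (x, w))).
Proof.
move=> sh fh; apply: (@smooth_along_coind _ _ _ (fun g => exists h,
  [/\ smooth_along (fun z : V * W => D z.1 /\ z.2 = 0) h, fiber_Cc h &
      g = fun x => J (fun w => h (x, w))])); last by exists h.
move=> _ [{sh fh}h [sh fh ->]]; have ch := smooth_along_continuous sh.
split=> [|v Dv]; first exact: radon_param_continuous.
have hd x : is_derive x v (fun x => J (fun w => h (x, w)))
    (J (fun w => 'D_(v, 0) h (x, w))).
  apply: is_derive_radon_param => // [z|]; first exact: smooth_along_derivable sh.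
  by apply/smooth_along_continuous/(smooth_along_derive _ sh).
split=> [x|]; first by case: (hd x).
exists ('D_(v, 0) h); split; [exact: smooth_along_derive|exact: fiber_Cc_derive|].
by apply/funext => x; case: (hd x).
Qed.

Lemma radon_param_smooth h : smooth_along along1 h -> fiber_Cc h ->
  smooth_real (fun x => J (fun w => h (x, w))).
Proof.
move=> sh fh; apply/smooth_realE/radon_param_smooth_along => //.
by apply: smooth_along_sub sh => z [].
Qed.

Lemma iter_deriv_radon_param h vs : smooth_along along1 h -> fiber_Cc h ->
  iter_deriv vs (fun x => J (fun w => h (x, w))) =
  fun x => J (fun w => iter_deriv [seq direction v | v <- vs] h (x, w)).
Proof.
move=> sh fh; elim/last_ind: vs h sh fh => [//|vs v IH] h sh fh.
rewrite map_rcons !iter_deriv_rcons -IH; last 2 first.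
- exact: smooth_along_derive.
- exact: fiber_Cc_derive.
congr iter_deriv; apply/funext => x; apply: (@derive_val _ _ _ _ _ _ _ _).
apply: is_derive_radon_param => // [|z|]; first exact: smooth_along_continuous sh.
- exact: smooth_along_derivable sh.
- exact/smooth_along_continuous/(smooth_along_derive _ sh).
Qed.

End Parametric.

(** * Construction of Radon functionals *)

Lemma compact_fst V W (K : set (V * W)) : compact K -> compact (fst @` K).
Proof.
move=> cK; apply: continuous_compact => //.
by apply: continuous_subspaceT => z; exact: cvg_fst.
Qed.

Lemma compact_snd V W (K : set (V * W)) : compact K -> compact (snd @` K).
Proof.
move=> cK; apply: continuous_compact => //.
by apply: continuous_subspaceT => z; exact: cvg_snd.
Qed.

Lemma Cc_fiber_Cc V W (f : V * W -> R) : Cc f -> fiber_Cc f.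
Proof.
case=> cf [K cK Kf] x0; exists (snd @` K); first exact: compact_snd.
by apply: filterE => x w nw; apply: Kf => Kxw; apply: nw; exists (x, w).
Qed.

Lemma Cc_radon_fiber V W (J : (W -> R) -> R) (f : V * W -> R) : radon J ->
  Cc f -> Cc (fun v => J (fun w => f (v, w))).
Proof.
move=> rJ cf; split.
  by apply: (radon_param_continuous rJ (h := f)); [exact: Cc_continuous|exact: Cc_fiber_Cc].
have [_ [K cK Kf]] := cf; exists (fst @` K); first exact: compact_fst.
move=> v nv; rewrite -(radon0 rJ); congr J; apply/funext => w.
by apply: Kf => Kvw; apply: nv; exists (v, w).
Qed.

Lemma radon_prod V W (J1 : (V -> R) -> R) (J2 : (W -> R) -> R) :
  radon J1 -> radon J2 ->
  radon (fun f : V * W -> R => J1 (fun v => J2 (fun w => f (v, w)))).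
Proof.
move=> r1 r2.
have c2 (f : V * W -> R) v : Cc f -> Cc (fun w => f (v, w)).
  by move=> cf; apply: fiber_Cc_Cc; [exact: Cc_continuous|exact: Cc_fiber_Cc].
have c1 (f : V * W -> R) : Cc f -> Cc (fun v => J2 (fun w => f (v, w))).
  exact: Cc_radon_fiber.
have van1 K (f : V * W -> R) : vanish_off K f ->
    vanish_off (fst @` K) (fun v => J2 (fun w => f (v, w))).
  move=> Kf v nv; rewrite -(radon0 r2); congr J2; apply/funext => w.
  by apply: Kf => Kvw; apply: nv; exists (v, w).
split.
- move=> a f g cf cg; rewrite -(radon_linear r1); [|exact: c1..].
  by congr J1; apply/funext => v; rewrite -(radon_linear r2)//; exact: c2.
- move=> K cK; have [C1 C10 h1] := radon_bound r1 (compact_fst cK).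
  have [C2 C20 h2] := radon_bound r2 (compact_snd cK).
  exists (C1 * C2) => [|f M cf Kf Mf]; first exact: mulr_ge0.
  have Ccf : Cc f by split=> //; exists K.
  rewrite -mulrA; apply: h1; [exact/Cc_continuous/c1|exact: van1|move=> v].
  apply: h2 => [|w nw|w]; [exact/Cc_continuous/c2| |exact: Mf].
  by apply: Kf => Kvw; apply: nw; exists (v, w).
- move=> f cf f0 [v w] fvw; apply: (radon_gt0 r1 (c1 _ cf) _ (w := v)).
    by move=> v'; apply: (radon_ge0 r2) => //; exact: c2.
  exact: (radon_gt0 r2 (c2 _ _ cf) _ (w := w)).
Qed.

Lemma Cc_iso V W (p : V -> W) (q : W -> V) f : continuous p -> continuous q ->
  cancel p q -> Cc f -> Cc (f \o p).
Proof.
move=> cp cq pK [cf [K cK Kf]]; split.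
  by move=> v; apply: continuous_comp; [exact: cp|exact: cf].
exists (q @` K); first by apply: continuous_compact => //; exact: continuous_subspaceT.
by move=> v nv; apply: Kf => Kp; apply: nv; exists (p v).
Qed.

Lemma radon_iso V W (p : V -> W) (q : W -> V) (J : (V -> R) -> R) :
  continuous p -> continuous q -> cancel p q -> cancel q p -> radon J ->
  radon (fun f => J (f \o p)).
Proof.
move=> cp cq pK qK rJ; split.
- move=> a f g cf cg.
  by rewrite -(radon_linear rJ); [|exact: Cc_iso cp cq pK _..].
- move=> K cK; have [|C C0 hC] := radon_bound rJ (K := q @` K).
    by apply: continuous_compact => //; exact: continuous_subspaceT.
  exists C => // f M cf Kf Mf; apply: hC => [v|v nv|v].
  + by apply: continuous_comp; [exact: cp|exact: cf].
  + by apply: Kf => Kp; apply: nv; exists (p v).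
  + exact: Mf.
- move=> f cf f0 w fw; apply: (radon_gt0 rJ _ _ (w := q w)) => [|v|].
  + exact: Cc_iso cp cq pK _.
  + exact: f0.
  + by rewrite /= qK.
Qed.

Definition transl_inv W (J : (W -> R) -> R) :=
  forall v f, Cc f -> J (fun w => f (v + w)) = J f.

Lemma Cc_transl W (v : W) f : Cc f -> Cc (fun w => f (v + w)).
Proof.
apply: (@Cc_iso W W (+%R v) (+%R (- v))) => [w|w|w]; last by rewrite addKr.
  by apply: cvgD; [exact: cvg_cst|exact: cvg_id].
by apply: cvgD; [exact: cvg_cst|exact: cvg_id].
Qed.

(** Integration by parts in disguise: translation invariance makes
    [t |-> J (f (t v + .))] constant, and its derivative at [0] is [J (D_v f)]. *)
Lemma radon_derive_eq0 W (J : (W -> R) -> R) v f : radon J -> transl_inv J ->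
  Cc f -> (forall w, derivable f w v) -> continuous ('D_v f) -> J ('D_v f) = 0.
Proof.
move=> rJ tJ cf df cDf; pose h (z : R * W) := f (z.1 *: v + z.2).
pose p (z : R * W) := z.1 *: v + z.2.
have cp : continuous p.
  move=> z; apply: cvgD; last exact: cvg_snd.
  by apply: cvgZ; [exact: cvg_fst|exact: cvg_cst].
have aff : affine_along p (1, 0) v.
  by move=> z t; rewrite /p/= scaler0 add0r scalerDl addrA [_%:A]mulr1.
have fh : fiber_Cc h.
  move=> t0; have [_ [K cK Kf]] := cf.
  exists ((fun z : R * W => - z.1 *: v + z.2) @` (`[t0 - 1, t0 + 1] `*` K)).
    apply: continuous_compact; last by apply: compact_setX => //; exact: segment_compact.
    apply: continuous_subspaceT => z; apply: cvgD; last exact: cvg_snd.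
    by apply: cvgZ; [apply: cvgN; exact: cvg_fst|exact: cvg_cst].
  near=> t => w nw; apply: Kf => /= Kw; apply: nw; exists (t, t *: v + w).
    split=> //=; rewrite in_itv/= -ler_distlC; near: t.
    by apply: filterS (nbhsx_ballx t0 1 _) => // t; rewrite /ball/= => /ltW.
  by rewrite /= scaleNr addKr.
have ch : continuous h.
  by move=> z; apply: continuous_comp; [exact: cp|exact: Cc_continuous].
have dh z : derivable h z (1, 0) by apply: (derivable_comp_affine aff); exact: df.
have Dh : 'D_(1, 0) h = 'D_v f \o p.
  by apply/funext => z; exact: (derive_comp_affine f z aff).
have cDh : continuous ('D_(1, 0) h).
  by rewrite Dh => z; apply: continuous_comp; [exact: cp|exact: cDf].
have := @derive_val _ _ _ _ _ _ _ (is_derive_radon_param rJ 0 ch fh dh cDh).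
rewrite (_ : (fun x => J _) = fun=> J f); last first.
  by apply/funext => t; rewrite -[RHS](tJ (t *: v)).
rewrite derive_cst => ->; congr J; apply/funext => w.
by have /= -> := congr1 (@^~ (0, w)) Dh; rewrite /p/= scale0r add0r.
Unshelve. all: by end_near. Qed.


End RadonFunctionals.

(** * Lebesgue integration as a Radon functional *)

Section LebesgueRadon.
Context {R : realType}.
Notation mu := (@lebesgue_measure R).

Definition line_integral (f : R -> R) : R := \int[mu]_t f t.

Lemma compact_itv (K : set R) : compact K -> exists2 A, 0 < A & K `<=` `[- A, A].
Proof.
move=> /compact_bounded /pinfty_ex_gt0 [A A0 hA]; exists A => // t /hA.
by rewrite /= in_itv/= ler_norml.
Qed.

Lemma vanish_off_restrict (K : set R) (A : R) f :
  K `<=` `[- A, A] -> vanish_off K f -> f \_ `[- A, A] = f.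
Proof.
move=> KA Kf; apply/funext => t; rewrite patchE; case: ifPn => //.
by rewrite notin_setE => tA; rewrite Kf// => /KA.
Qed.

Lemma Cc_integrable (f : R -> R) : Cc f -> mu.-integrable setT (EFin \o f).
Proof.
case=> cf [K /compact_itv[A A0 KA] Kf].
rewrite -(vanish_off_restrict KA Kf) -restrict_EFin.
apply/(integrable_mkcond _ _).1 => //.
by apply: continuous_compact_integrable; [exact: segment_compact|exact: continuous_subspaceT].
Qed.

Lemma Rintegral_itv_cst (a b c : R) : a < b ->
  \int[mu]_(t in `[a, b]) c = c * (b - a).
Proof.
move=> ab; transitivity (c * fine (mu `[a, b]%classic)); first exact: Rintegral_cst.
by rewrite lebesgue_measure_itv/= lte_fin ab.
Qed.

Lemma radon_line_integral : radon line_integral.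
Proof.
split.
- move=> a f g cf cg; rewrite /line_integral RintegralD//; last 2 first.
  + by apply: (Cc_integrable (f := fun t => a * f t)); exact: CcZ.
  + exact: Cc_integrable.
  by rewrite RintegralZl//; exact: Cc_integrable.
- move=> K /compact_itv[A A0 KA]; exists (A + A) => [|f M cf Kf Mf]; first by lra.
  have If : mu.-integrable `[- A, A] (EFin \o f).
    by apply: continuous_compact_integrable; [exact: segment_compact|exact: continuous_subspaceT].
  rewrite /line_integral -(vanish_off_restrict KA Kf) -Rintegral_mkcond.
  apply: le_trans (le_normr_Rintegral _ If) _ => //.
  apply: (@le_trans _ _ (\int[mu]_(t in `[- A, A]) M)).
    apply: le_Rintegral => //.
    - exact: integrable_norm If.
    - apply: continuous_compact_integrable; first exact: segment_compact.
      by apply: continuous_subspaceT => ?; exact: cst_continuous.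
  by rewrite Rintegral_itv_cst ?opprK 1?mulrC//; lra.
- move=> f cf f0 w fw.
  have fw2 : 0 < f w / 2 by lra.
  have /cvgrPdist_lt/(_ _ fw2) /nbhs_ballP[d /= d0 hd] := Cc_continuous cf (x := w).
  have itvD : w - d / 2 < w + d / 2 by lra.
  apply: (@lt_le_trans _ _ (\int[mu]_(t in `[w - d / 2, w + d / 2]) (f w / 2))).
    by rewrite Rintegral_itv_cst//; apply: mulr_gt0 => //; lra.
  have fD : {within `[w - d / 2, w + d / 2], continuous f}.
    by apply: continuous_subspaceT; exact: Cc_continuous.
  have If : mu.-integrable `[w - d / 2, w + d / 2] (EFin \o f).
    by apply: continuous_compact_integrable => //; exact: segment_compact.
  apply: (@le_trans _ _ (\int[mu]_(t in `[w - d / 2, w + d / 2]) f t)).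
    apply: le_Rintegral => //.
      apply: continuous_compact_integrable; first exact: segment_compact.
      by apply: continuous_subspaceT => ?; exact: cst_continuous.
    move=> t; rewrite /= in_itv/= => /andP[t1 t2].
    have : `|f w - f t| < f w / 2.
      by apply: hd; rewrite -ball_normE/= ltr_norml; apply/andP; split; lra.
    by rewrite ltr_norml => /andP[_]; lra.
  rewrite Rintegral_mkcond; apply: le_Rintegral => //.
  + by rewrite -restrict_EFin; apply/(integrable_mkcond _ _).1.
  + exact: Cc_integrable.
  + by move=> t _; rewrite patchE; case: ifPn.
Qed.

(** The substitution theorem for the whole line concerns nonnegative functions,
    whence the decomposition [f = (f + |f|) - |f|]. *)
Lemma line_integral_transl : transl_inv line_integral.
Proof.
have pos (f : R -> R) c : Cc f -> (forall t, 0 <= f t) ->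
    line_integral (fun t => f (c + t)) = line_integral f.
  move=> cf f0; pose F (t : R) := c + t.
  have F' : F^`()%classic = fun=> 1.
    apply/funext => t; rewrite derive1E deriveD//.
    by rewrite derive_cst derive_id add0r.
  rewrite /line_integral /Rintegral; congr fine; symmetry.
  rewrite (@increasing_ge0_integration_by_substitutionT _ F f) ?F'//.
  - by apply: eq_integral => t _; rewrite /= mulr1.
  - by move=> x y xy; rewrite ltrD2l.
  - by move=> ?; exact: cst_continuous.
  - exact: is_cvg_cst.
  - exact: is_cvg_cst.
  - apply/cvgrNyPle => A; near=> t; rewrite /F -lerBrDl; near: t.
    by apply: nbhs_ninfty_le; exact: num_real.
  - apply/cvgryPge => A; near=> t; rewrite /F -lerBlDl; near: t.
    by apply: nbhs_pinfty_ge; exact: num_real.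
  - exact: Cc_continuous.
move=> c f cf; have cn : Cc (fun t => `|f t|).
  case: cf => cf [K cK Kf]; split.
    by move=> t; apply: (continuous_comp (cf t)); exact: norm_continuous.
  by exists K => // t /Kf ->; rewrite normr0.
have split_f : f = fun t => (f t + `|f t|) - `|f t| by apply/funext => t; rewrite addrK.
rewrite [in RHS]split_f [in LHS]split_f !(radonB radon_line_integral)//.
- rewrite (pos _ c (CcD cf cn)) ?(pos _ c cn)// => t.
  by rewrite -lerBlDl sub0r -normrN ler_norm.
- exact: CcD.
- exact: Cc_transl (CcD cf cn).
- exact: Cc_transl cn.
Unshelve. all: by end_near. Qed.

Fixpoint space_integral n : ('rV[R]_n -> R) -> R :=
  match n with
  | 0%N => fun f => f 0
  | n'.+1 => fun f => line_integral (fun t => space_integral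
        (fun v : 'rV[R]_n' => f (row_mx (t%:M : 'rV[R]_1) v)))
  end.

Definition rV_cons n (z : R * 'rV[R]_n) : 'rV[R]_(n.+1) :=
  row_mx (z.1%:M : 'rV[R]_1) z.2.
Definition rV_split n (v : 'rV[R]_(n.+1)) : R * 'rV[R]_n :=
  (v 0 0, rsubmx (v : 'rV[R]_(1 + n))).

Lemma rV_consK n : cancel (@rV_cons n) (@rV_split n).
Proof.
case=> t v; rewrite /rV_split /rV_cons row_mxKr; congr pair.
by rewrite mxE; case: splitP => //= k _; rewrite ord1 mxE eqxx.
Qed.

Lemma rV_splitK n : cancel (@rV_split n) (@rV_cons n).
Proof.
move=> v; transitivity (row_mx (lsubmx (v : 'rV[R]_(1 + n))) (rsubmx (v : 'rV[R]_(1 + n)))).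
  rewrite /rV_cons /=; f_equal.
  apply/rowP => i; rewrite !ord1 !mxE eqxx mulr1n; congr (v 0 _); exact: val_inj.
exact: (@hsubmxK R 1 1 n v).
Qed.

Lemma rV_consD n (y z : R * 'rV[R]_n) : rV_cons (y + z) = rV_cons y + rV_cons z.
Proof.
apply/rowP => i; rewrite !mxE; case: fintype.split => k; rewrite !mxE//.
by rewrite mulrnDl.
Qed.

Lemma continuous_rV (T : topologicalType) n (f : T -> 'rV[R]_n) :
  (forall i, continuous (fun x => f x 0 i)) -> continuous f.
Proof.
move=> cf x; apply/cvgrPdist_lt => e e0.
have : \forall y \near nbhs x, forall i, `|f x 0 i - f y 0 i| < e.
  by apply: filter_forall => i; have /cvgrPdist_lt := cf i x; exact.
apply: filterS => y hy; rewrite [ltLHS]/Num.Def.normr/= mx_normrE.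
by apply/bigmax_ltP; split=> // -[a i] _; rewrite !mxE ord1.
Qed.

Lemma continuous_rV_cons n : continuous (@rV_cons n).
Proof.
apply: continuous_rV => i z; rewrite /rV_cons.
rewrite (_ : (fun x => _) = fun x : R * 'rV[R]_n =>
  match fintype.split (i : 'I_(1 + n)) with inl _ => x.1 | inr k => x.2 0 k end); last first.
  apply/funext => -[t v] /=; rewrite mxE; case: fintype.split => k //.
  by rewrite ord1 mxE eqxx.
case: fintype.split => k; first exact: cvg_fst.
apply: (@cvg_comp _ _ _ snd (fun v : 'rV[R]_n => v 0 k) _ (nbhs z.2)); first exact: cvg_snd.
exact: coord_continuous.
Qed.

Lemma continuous_rV_split n : continuous (@rV_split n).
Proof.
have cr : continuous (fun v : 'rV[R]_n.+1 => rsubmx (v : 'rV[R]_(1 + n))).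
  apply: continuous_rV => i w.
  have -> : (fun v : 'rV[R]_n.+1 => (rsubmx (v : 'rV[R]_(1 + n))) 0 i) =
      fun v : 'rV[R]_(1 + n) => v 0 (rshift 1 i) by apply/funext => v; rewrite mxE.
  exact: coord_continuous.
by move=> v; exact: (cvg_pair (@coord_continuous R 1 n.+1 0 0 v) (cr v)).
Qed.

Lemma radon_space_integral n : radon (@space_integral n).
Proof.
elim: n => [|n IH].
  have all0 (w : 'rV[R]_0) : w = 0 by apply/rowP => -[].
  split=> [//|K _|f _ _ w]; last by rewrite (all0 w).
  by exists 1 => // f M _ _ Mf; rewrite mul1r; exact: Mf.
exact: (radon_iso (@continuous_rV_cons n) (@continuous_rV_split n)
  (@rV_consK n) (@rV_splitK n) (radon_prod radon_line_integral IH)).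
Qed.

Lemma space_integral_transl n : transl_inv (@space_integral n).
Proof.
elim: n => [|n IH] v f cf; first by rewrite /= addr0; congr f; apply/rowP => -[].
have cfc : Cc (f \o @rV_cons n).
  exact: Cc_iso (@continuous_rV_cons n) (@continuous_rV_split n) (@rV_consK n) cf.
have fib : fiber_Cc (f \o @rV_cons n) by exact: Cc_fiber_Cc.
pose g t := space_integral (fun w => (f \o @rV_cons n) (t, w)).
have cg : Cc g by apply: (Cc_radon_fiber (radon_space_integral n) cfc).
rewrite -[RHS](line_integral_transl (rV_split v).1 cg) /=; congr line_integral.
apply/funext => t; rewrite /g -[RHS](IH (rV_split v).2); last first.
  by apply: fiber_Cc_Cc => //; exact: Cc_continuous.
congr space_integral; apply/funext => w; rewrite /=; congr f.
rewrite -[v in LHS]rV_splitK; exact: esym (rV_consD _ (t, w)).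
Qed.

End LebesgueRadon.

(** * Concentration of powers at a peak *)

Section Peak.
Context {R : realType} {W : normedModType R} {J : (W -> R) -> R} (rJ : radon J).
Variables (tau : W -> R) (w0 : W).

(** The powers of such a [tau] concentrate at [w0]: after normalization they form
    an approximate identity, with no rescaling of a bump and no explicit constants.
    Smooth bumps localize directions, and parabolas give the Landau kernels. *)
Record peak : Prop := Peak {
  peak_Cc : Cc tau;
  peak_ge0 : forall w, 0 <= tau w;
  peak_max : tau w0 = 1;
  peak_lt1 : forall w, w != w0 -> tau w < 1 }.

Hypothesis ptau : peak.

Lemma peak_le1 w : tau w <= 1.
Proof.
by have [->|/(peak_lt1 ptau)/ltW//] := eqVneq w w0; rewrite (peak_max ptau).
Qed.

Lemma peak_CcX k : Cc (fun w => tau w ^+ k.+1).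
Proof.
elim: k => [|k IH]; first by under eq_fun do rewrite expr1; exact: peak_Cc.
by under eq_fun do rewrite exprS; apply: CcM => //; exact/Cc_continuous/peak_Cc.
Qed.

Lemma peak_radon_gt0 k : 0 < J (fun w => tau w ^+ k.+1).
Proof.
apply: (radon_gt0 rJ (peak_CcX k) _ (w := w0)); last by rewrite (peak_max ptau) expr1n.
by move=> w; rewrite exprn_ge0// (peak_ge0 ptau).
Qed.

(** If every ratio [J (tau^(k+1)) / J (tau^k)] were at most [1 - e], the
    integrals of the powers would decay like [(1 - e)^k]; but the region where
    [tau > 1 - e / 2] keeps them above a multiple of [(1 - e / 2)^k]. *)
Lemma peak_ratio e : 0 < e -> exists k,
  J (fun w => (1 - tau w) * tau w ^+ k.+1) <= e * J (fun w => tau w ^+ k.+1).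
Proof.
move=> e0; apply: contrapT => /forallNP nk.
pose a k := J (fun w => tau w ^+ k.+1).
have a_gt0 k : 0 < a k := peak_radon_gt0 k.
have step k : a k.+1 < (1 - e) * a k.
  have /negP := nk k; rewrite -ltNge -/(a k).
  have -> : J (fun w => (1 - tau w) * tau w ^+ k.+1) = a k - a k.+1.
    rewrite /a -(radonB rJ); [|exact: peak_CcX..].
    by congr J; apply/funext => w; rewrite [tau w ^+ k.+2]exprS mulrBl mul1r.
  by move: (a_gt0 k) => ?; lra.
have e1 : e < 1.
  have := lt_trans (a_gt0 1) (step 0); rewrite pmulr_lgt0//; lra.
have decay k : a k <= (1 - e) ^+ k * a 0.
  elim: k => [|k IH]; first by rewrite expr0 mul1r.
  rewrite exprS -mulrA; apply: le_trans (ltW (step k)) _.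
  by rewrite ler_pM2l//; lra.
(* [eta] is supported where [tau >= 1 - e / 2]. *)
pose eta w := Num.max 0 (tau w - (1 - e / 2)).
have ceta : Cc eta.
  have [ct [K cK Kt]] := peak_Cc ptau; split.
    move=> w; apply: (@continuous_max R W (cst 0)); first exact: cvg_cst.
    by apply: cvgB; [exact: ct|exact: cvg_cst].
  by exists K => // w nK; rewrite /eta Kt// max_l//; lra.
have eta0 w : 0 <= eta w by rewrite le_max lexx.
have Jeta : 0 < J eta.
  apply: (radon_gt0 rJ ceta eta0 (w := w0)).
  by rewrite lt_max (peak_max ptau); apply/orP; right; lra.
have grow k : (1 - e / 2) ^+ k.+1 * J eta <= a k.
  rewrite -(radonZ rJ)//; apply: (radon_le rJ); [exact: CcZ|exact: peak_CcX|].
  move=> w; rewrite /eta; have [h|h] := leP (tau w - (1 - e / 2)) 0.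
    by rewrite mulr0 exprn_ge0// (peak_ge0 ptau).
  have t1 := peak_le1 w.
  apply: (@le_trans _ _ ((1 - e / 2) ^+ k.+1)).
    by rewrite ler_piMr ?exprn_ge0//; lra.
  by rewrite lerXn2r ?nnegrE ?(peak_ge0 ptau)//; lra.
pose q := (1 - e) / (1 - e / 2).
have q0 : 0 <= q by apply: divr_ge0; lra.
have q1 : q < 1 by rewrite /q ltr_pdivrMr ?mul1r; lra.
pose c := (1 - e / 2) * J eta / a 0.
have c0 : 0 < c by rewrite divr_gt0 ?mulr_gt0//; lra.
have qc k : c <= q ^+ k.
  rewrite /c ler_pdivrMr// /q expr_div_n mulrAC ler_pdivlMr ?exprn_gt0//; last by lra.
  by rewrite mulrAC -exprS; apply: le_trans (grow k) (decay k).
have /cvgrPdist_lt/(_ c c0)[k _ /(_ k (leqnn k))] : q ^+ k @[k --> \oo] --> 0.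
  by apply: cvg_expr; rewrite ger0_norm.
by rewrite sub0r normrN ger0_norm ?exprn_ge0// ltNge qc.
Qed.

Lemma radon_norm_le f g : Cc f -> Cc g -> (forall w, `|f w| <= g w) ->
  `|J f| <= J g.
Proof.
move=> cf cg fg; rewrite ler_norml; apply/andP; split.
  have cNg : Cc (fun w => - 1 * g w) by exact: CcZ.
  rewrite -[- J g]mulN1r -(radonZ rJ)//; apply: (radon_le rJ) => // w.
  by have := fg w; rewrite ler_norml mulN1r => /andP[].
by apply: (radon_le rJ) => // w; apply: le_trans (fg w); exact: ler_norm.
Qed.

(** This modulus of continuity at [w0] is stable under finite unions of families,
    which is how all derivatives up to a given order are treated together. *)
Definition peak_modulus X (S : set X) (Phi : X -> W -> R) := forall e, 0 < e ->
  exists2 C, 0 <= C & forall x w, S x ->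
    tau w != 0 -> `|Phi x w - Phi x w0| <= e + C * (1 - tau w).

Lemma peak_concentration X (S : set X) (Phi : X -> W -> R) e :
  (forall x, continuous (Phi x)) -> peak_modulus S Phi -> 0 < e ->
  exists k, forall x, S x ->
  `|J (fun w => tau w ^+ k.+1 * Phi x w) - J (fun w => tau w ^+ k.+1) * Phi x w0|
    <= e * J (fun w => tau w ^+ k.+1).
Proof.
move=> cPhi mPhi e0; have [|C C0 hC] := mPhi (e / 2); first by lra.
have [|k hk] := @peak_ratio (e / 2 / (C + 1)); first by rewrite !divr_gt0//; lra.
exists k => x Sx; set a := J (fun w => tau w ^+ k.+1).
have cf : Cc (fun w => tau w ^+ k.+1 * Phi x w).
  by under eq_fun do rewrite mulrC; apply: CcM => //; exact: peak_CcX.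
have cg : Cc (fun w => Phi x w0 * tau w ^+ k.+1) by apply/CcZ/peak_CcX.
have c1 : Cc (fun w => (1 - tau w) * tau w ^+ k.+1).
  apply: CcM; last exact: peak_CcX.
  by move=> w; apply: cvgB; [exact: cvg_cst|exact/Cc_continuous/peak_Cc].
rewrite mulrC /a -(radonZ rJ); last exact: peak_CcX.
rewrite -(radonB rJ)//.
apply: (@le_trans _ _ (J (fun w => e / 2 * tau w ^+ k.+1 + C * ((1 - tau w) * tau w ^+ k.+1)))).
  apply: radon_norm_le; first exact: CcB.
    by apply: CcD; apply: CcZ => //; exact: peak_CcX.
  move=> w; have [t0|tn0] := eqVneq (tau w) 0; first
    by rewrite t0 !exprS !(mul0r, mulr0) subrr normr0 addr0.
  have tk0 : 0 <= tau w ^+ k.+1 by rewrite exprn_ge0// (peak_ge0 ptau).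
  rewrite [X in `|X|](_ : _ = tau w ^+ k.+1 * (Phi x w - Phi x w0)); last by ring.
  rewrite [leRHS](_ : _ = tau w ^+ k.+1 * (e / 2 + C * (1 - tau w))); last by ring.
  by rewrite normrM ger0_norm// ler_wpM2l// hC.
rewrite (radonD rJ); [|apply: CcZ; exact: peak_CcX|exact: CcZ].
rewrite !(radonZ rJ)//; last exact: peak_CcX.
rewrite -/a [in leRHS](splitr e) mulrDl lerD2l.
apply: le_trans (ler_wpM2l C0 hk) _; rewrite -/a mulrA ler_wpM2r//.
  exact/ltW/peak_radon_gt0.
by rewrite mulrCA ler_piMr//; [lra|rewrite ler_pdivrMr; lra].
Qed.

(** Near [w0] continuity gives the bound [e]; away from [w0] the factor
    [1 - tau w] is bounded below, and a large [C] absorbs the difference.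
    Compactness of [S] and of the support of [tau] makes [C] uniform. *)
Lemma compact_peak_modulus (V : normedModType R) (S : set V) (Phi : V * W -> R) :
  compact S -> continuous Phi -> peak_modulus S (fun x w => Phi (x, w)).
Proof.
move=> cS cPhi e e0; have [ct [K cK Kt]] := peak_Cc ptau.
have cSK : compact (S `*` K) by exact: compact_setX.
pose good (C : R) (z : V * W) := `|Phi z - Phi (z.1, w0)| <= e + C * (1 - tau z.2).
pose d z : R := `|Phi z - Phi (z.1, w0)|.
have cd : continuous d.
  move=> z; apply: (@cvg_norm _ _ _ _ _ (fun z => Phi z - Phi (z.1, w0))).
  apply: (@cvgB _ _ _ _ _ Phi (fun z => Phi (z.1, w0))); first exact: cPhi.
  apply: (cvg_comp (fun z : V * W => (z.1, w0)) Phi); last exact: cPhi.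
  by apply: cvg_pair; [exact: cvg_fst|exact: cvg_cst].
have ct2 : continuous (fun z : V * W => tau z.2).
  by move=> z; apply: (cvg_comp snd tau); [exact: cvg_snd|exact: ct].
have [C0 C0P] : \forall C \near +oo, S `*` K `<=` good C.
  move/compact_near_coveringP : cSK => /(_ _ (pinfty_nbhs R) good); apply.
  move=> [x w] [/= Sx Kw]; have [->|ww0] := eqVneq w w0.
    have dw : d (x, w0) < e by rewrite /d subrr normr0.
    exists ([set z | d z < e], [set C | 0 <= C]) => /=.
      split; last by apply: nbhs_pinfty_ge; exact: num_real.
      exact: (cvgr_lt _ (cd (x, w0)) _ dw).
    move=> [z C] /= [dz Cp]; apply: le_trans (ltW dz) _.
    by rewrite lerDl mulr_ge0// subr_ge0 peak_le1.
  have t1 := peak_lt1 ptau ww0; pose c := (1 - tau w) / 2.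
  have c0 : 0 < c by rewrite /c; lra.
  exists ([set z | d z < d (x, w) + 1] `&` [set z | tau z.2 < 1 - c],
    [set C | (d (x, w) + 1) / c <= C]) => /=.
    split; last by apply: nbhs_pinfty_ge; exact: num_real.
    apply: filterI.
      by apply: (cvgr_lt (d (x, w)) (cd (x, w))); rewrite ltrDl.
    by apply: (cvgr_lt (tau w) (ct2 (x, w))); rewrite /c; lra.
  move=> [z C] /= [[dz tz] Cp]; apply: le_trans (ltW dz) _.
  move: Cp; rewrite ler_pdivrMr// => Cp.
  have C0 : 0 <= C by rewrite -(pmulr_lge0 _ c0) (le_trans _ Cp)// addr_ge0 /d.
  apply: le_trans Cp _; apply: (@le_trans _ _ (C * (1 - tau z.2))).
    by rewrite ler_wpM2l//; lra.
  by rewrite lerDr ltW.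
case: C0P => _ C0P; exists (`|C0| + 1); first by rewrite addr_ge0.
move=> x w Sx tw; apply: (C0P (`|C0| + 1) _ (x, w)).
  by rewrite (le_lt_trans (ler_norm C0))// ltrDl.
split=> //=; apply: contrapT => nK; by move: tw; rewrite Kt// eqxx.
Qed.

End Peak.

(** * Compactly supported distributions acting on real functions *)

Section RealDistributions.
Context {R : realType} {n : nat}.
Notation V := 'rV[R]_n.

Definition basis_dirs (alpha : seq 'I_n) : seq V := [seq delta_mx 0 j | j <- alpha].

(** The restriction to real functions of the real or of the imaginary part of an
    element of E'(R^n). *)
Record real_dist (u : (V -> R) -> R) : Prop := RealDist {
  real_dist_linear : forall a f g, smooth_real f -> smooth_real g ->
    u (fun x => a * f x + g x) = a * u f + u g;
  real_dist_bound : exists (K : set V) (N : nat) (c : R), [/\ compact K, 0 <= c &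
    forall f M, smooth_real f -> 0 <= M ->
      (forall alpha, (size alpha <= N)%N -> forall x, K x ->
         `|iter_deriv (basis_dirs alpha) f x| <= M) ->
      `|u f| <= c * M] }.

Lemma iter_deriv0 (U : normedModType R) (vs : seq U) :
  iter_deriv vs (fun=> 0) = fun=> 0 : R.
Proof. by elim: vs => //= v vs ->; apply/funext => y; exact: derive_cst. Qed.

Lemma iter_deriv_lin (U : normedModType R) D (vs : seq U) (a : R) (f g : U -> R) :
  smooth_along D f -> smooth_along D g -> (forall v, v \in vs -> D v) ->
  iter_deriv vs (fun x => a * f x + g x) =
  fun x => a * iter_deriv vs f x + iter_deriv vs g x.
Proof.
elim/last_ind: vs f g => [//|vs v IH] f g sf sg Dvs; rewrite !iter_deriv_rcons.
have Dv : D v by apply: Dvs; rewrite mem_rcons mem_head.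
rewrite -IH; last 3 first.
- exact: smooth_along_derive.
- exact: smooth_along_derive.
- by move=> w wvs; apply: Dvs; rewrite mem_rcons inE wvs orbT.
congr iter_deriv; apply/funext => x.
have df : derivable f x v by exact: smooth_along_derivable sf.
have dg : derivable g x v by exact: smooth_along_derivable sg.
transitivity ('D_v (a *: f + g) x); first by [].
rewrite (deriveD _ dg); last exact: derivableZ.
by rewrite (deriveZ _ df).
Qed.

Section Consequences.
Variables (u : (V -> R) -> R) (ru : real_dist u).

Lemma smooth_real_cst (c : R) : smooth_real (fun _ : V => c).
Proof. by apply/smooth_realE; exact: smooth_along_cst. Qed.

Lemma smooth_realB (f g : V -> R) : smooth_real f -> smooth_real g ->
  smooth_real (fun x => f x - g x).
Proof. by move=> /smooth_realE ? /smooth_realE ?; apply/smooth_realE; exact: smooth_alongB. Qed.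

Lemma smooth_realZ c (f : V -> R) : smooth_real f -> smooth_real (fun x => c * f x).
Proof. by move=> /smooth_realE ?; apply/smooth_realE; exact: smooth_alongZ. Qed.

Lemma real_dist0 : u (fun=> 0) = 0.
Proof.
have := real_dist_linear ru 1 (smooth_real_cst 0) (smooth_real_cst 0).
under eq_fun do rewrite mulr0 addr0; lra.
Qed.

Lemma real_distZ a f : smooth_real f -> u (fun x => a * f x) = a * u f.
Proof.
move=> sf; have := real_dist_linear ru a sf (smooth_real_cst 0).
by under eq_fun do rewrite addr0; rewrite real_dist0 addr0.
Qed.

Lemma real_distD f g : smooth_real f -> smooth_real g ->
  u (fun x => f x + g x) = u f + u g.
Proof.
move=> sf sg; have := real_dist_linear ru 1 sf sg.
by under eq_fun do rewrite mul1r; rewrite mul1r.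
Qed.

Lemma real_dist_sum I (s : seq I) (F : I -> V -> R) : (forall i, smooth_real (F i)) ->
  u (fun x => \sum_(i <- s) F i x) = \sum_(i <- s) u (F i).
Proof.
move=> sF; elim: s => [|i s IH].
  by under eq_fun do rewrite big_nil; rewrite big_nil real_dist0.
under eq_fun do rewrite big_cons; rewrite big_cons -IH; apply: real_distD => //.
by apply/smooth_realE/smooth_along_sum => j; exact/smooth_realE.
Qed.

(** The seminorm bound vanishes on a function that is zero near [K], so that only
    the values on a large ball matter. *)
Lemma real_dist_local : exists2 A, 0 < A & forall f g, smooth_real f ->
  smooth_real g -> (forall x : V, `|x| < A -> f x = g x) -> u f = u g.
Proof.
have [K [N [c [cK c0 ub]]]] := real_dist_bound ru.
have [A A0 KA] := pinfty_ex_gt0 (compact_bounded cK).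
exists (A + 1) => [|f g sf sg fg]; first by rewrite addr_gt0.
have sfg : smooth_real (fun x => -1 * g x + f x).
  have -> : (fun x => -1 * g x + f x) = fun x => f x - g x.
    by apply/funext => x; rewrite mulN1r addrC.
  exact: smooth_realB.
have : u (fun x => -1 * g x + f x) = 0.
  apply/eqP; rewrite -normr_le0 -(mulr0 c); apply: ub => // alpha _ x Kx.
  suff : \forall y \near nbhs x, -1 * g y + f y = (fun=> 0) y.
    move=> /(near_eq_iter_deriv (basis_dirs alpha)) /nbhs_singleton ->.
    by rewrite iter_deriv0 normr0.
  have : \forall y \near nbhs x, `|y| < A + 1.
    apply: (cvgr_lt _ (@norm_continuous _ _ x)).
    by rewrite (le_lt_trans (KA _ Kx))// ltrDl.
  by apply: filterS => y /fg ->; rewrite mulN1r addNr.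
by rewrite (real_dist_linear ru)// mulN1r addrC => /subr0_eq.
Qed.

Section PeakAverages.
Variables (W : normedModType R) (J : (W -> R) -> R) (tau : W -> R) (w0 : W).
Hypotheses (rJ : radon J) (ptau : peak tau w0).

Lemma smooth_peak_weight k (H : V * W -> R) : smooth_along (@along1 R V W) H ->
  smooth_along (@along1 R V W) (fun z => tau z.2 ^+ k.+1 * H z).
Proof.
move=> sH; apply: smooth_alongM => //; apply: smooth_along_inv.
  move=> z; apply: (cvg_comp snd (fun w => tau w ^+ k.+1)); first exact: cvg_snd.
  exact: (Cc_continuous (peak_CcX ptau k)).
by move=> v v2 z t /=; rewrite v2 scaler0 add0r.
Qed.

Lemma fiber_Cc_peak_weight k (H : V * W -> R) :
  fiber_Cc (fun z => tau z.2 ^+ k.+1 * H z).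
Proof.
move=> x0; have [_ [L cL Lt]] := peak_Cc ptau; exists L => //.
by apply: filterE => x w nw; rewrite /= Lt// expr0n mul0r.
Qed.

Lemma smooth_peak_average k (H : V * W -> R) : smooth_along (@along1 R V W) H ->
  smooth_real (fun x => J (fun w => tau w ^+ k.+1 * H (x, w))).
Proof.
move=> sH; apply: (radon_param_smooth rJ (h := fun z => tau z.2 ^+ k.+1 * H z)).
  exact: smooth_peak_weight.
exact: fiber_Cc_peak_weight.
Qed.

End PeakAverages.

(** Averages of a family against concentrating weights [tau ^+ k.+1] converge
    to its member at the peak together with all derivatives, uniformly on
    compact sets. *)
Lemma real_dist_concentration (W : normedModType R) (J : (W -> R) -> R) tau w0
    (H : V * W -> R) :
  radon J -> peak tau w0 -> smooth_along (@along1 R V W) H ->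
  (forall k, u (fun x => J (fun w => tau w ^+ k.+1 * H (x, w))) = 0) ->
  u (fun x => H (x, w0)) = 0.
Proof.
move=> rJ ptau sH uJ0.
have [K [N [c [cK c0 ub]]]] := real_dist_bound ru.
pose Hk k (z : V * W) := tau z.2 ^+ k.+1 * H z.
have sHk k : smooth_along (@along1 R V W) (Hk k) by exact: (smooth_peak_weight ptau k sH).
have fHk k : fiber_Cc (Hk k) by exact: (fiber_Cc_peak_weight ptau k H).
pose D (alpha : seq 'I_n) := iter_deriv [seq (v, 0 : W) | v <- basis_dirs alpha] H.
have Dalong alpha v : v \in [seq (v, 0 : W) | v <- basis_dirs alpha] -> along1 v.
  by case/mapP => v' _ ->.
have DHk k vs : (forall v, v \in vs -> along1 v) -> forall h,
    smooth_along (@along1 R V W) h ->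
    iter_deriv vs (fun z => tau z.2 ^+ k.+1 * h z) =
    fun z => tau z.2 ^+ k.+1 * iter_deriv vs h z.
  elim/last_ind: vs => [//|vs v IH] Dvs h sh; rewrite !iter_deriv_rcons.
  have Dv : along1 v by apply: Dvs; rewrite mem_rcons mem_head.
  rewrite -IH; last exact: smooth_along_derive.
    congr iter_deriv; apply/funext => z.
    have -> : 'D_v (fun z => tau z.2 ^+ k.+1 * h z) z =
              'D_v (tau z.2 ^+ k.+1 \*o h) z.
      rewrite /derive; congr lim; set F := fun _ => _; set G := fun _ => _.
      suff -> : F = G by [].
      apply/funext => t; rewrite /F /G /= /shift/= Dv scaler0 add0r.
      by [].
    by rewrite (@deriveZ _ _ _ h)//; exact: smooth_along_derivable sh.
  by move=> w wvs; apply: Dvs; rewrite mem_rcons inE wvs orbT.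
have sD alpha : continuous (D alpha).
  by have [/(_ [seq (v, 0 : W) | v <- basis_dirs alpha])[|//]] := sH; exact: Dalong.
have sH0 : smooth_real (fun x => H (x, w0)).
  apply/smooth_realE; apply: (smooth_along_comp (f := H) (phi := fun x => (x, w0))
    (L := fun v => (v, 0)) (D' := @along1 R V W)) => //.
    exact: continuous_pairl.
  by move=> v _; split=> // x t; congr pair; rewrite /= scaler0 add0r.
have DH0 alpha : iter_deriv (basis_dirs alpha) (fun x => H (x, w0)) =
    fun x => D alpha (x, w0).
  rewrite /D; elim: (basis_dirs alpha) => [//|v vs IH] /=.
  by rewrite IH; apply/funext => x; rewrite derive_direction.
have sJk k : smooth_real (fun x => J (fun w => Hk k (x, w))).
  exact: (smooth_peak_average rJ ptau k sH).
have DJk k alpha x : iter_deriv (basis_dirs alpha) (fun x => J (fun w => Hk k (x, w))) x =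
    J (fun w => tau w ^+ k.+1 * D alpha (x, w)).
  rewrite iter_deriv_radon_param// (DHk k [seq (v, 0 : W) | v <- basis_dirs alpha])//.
  exact: Dalong.
pose X := (N.-bseq 'I_n * V)%type.
have modX : peak_modulus tau w0 [set z : X | K z.2] (fun z w => D z.1 (z.2, w)).
  move=> e e0.
  have /choice[C hC] : forall alpha : N.-bseq 'I_n, exists C, 0 <= C /\
      forall x w, K x -> tau w != 0 ->
      `|D alpha (x, w) - D alpha (x, w0)| <= e + C * (1 - tau w).
    move=> alpha; have [C ? ?] := compact_peak_modulus ptau cK (sD alpha) e0.
    by exists C.
  (* One constant for the finitely many derivatives of order at most [N]. *)
  exists (\sum_alpha C alpha); first by apply: sumr_ge0 => a _; case: (hC a).
  move=> [alpha x] w /= Kx tw; apply: le_trans (proj2 (hC alpha) x w Kx tw) _.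
  rewrite lerD2l ler_wpM2r ?subr_ge0 ?(peak_le1 ptau)//.
  by rewrite (bigD1 alpha)//= lerDl sumr_ge0// => a _; case: (hC a).
apply/eqP; rewrite -normr_le0; apply/ler_addgt0Pr => e e0; rewrite add0r.
have e'0 : 0 < e / (c + 1) by rewrite divr_gt0// ltr_wpDl.
have [|k hk] := peak_concentration rJ ptau _ modX e'0.
  move=> [alpha x] /= w; apply: (cvg_comp (fun w => (x, w)) (D alpha)); last exact: sD.
  exact: continuous_pairr.
set a := J (fun w => tau w ^+ k.+1) in hk.
have a0 : 0 < a by exact: (peak_radon_gt0 rJ ptau k).
have sdiff : smooth_real (fun x => (- a) * H (x, w0) + J (fun w => Hk k (x, w))).
  apply/smooth_realE/smooth_alongD; apply/smooth_realE; last exact: (sJk k).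
  exact: (smooth_realZ (- a) sH0).
have : `|u (fun x => (- a) * H (x, w0) + J (fun w => Hk k (x, w)))| <=
    c * (e / (c + 1) * a).
  apply: (ub _ _ sdiff); first by rewrite mulr_ge0// ltW.
  move=> alpha Na x Kx; rewrite (iter_deriv_lin (D := fun=> True)); last 3 first.
  - exact: (iffLR (smooth_realE _) sH0).
  - exact: (iffLR (smooth_realE _) (sJk k)).
  - by [].
  rewrite DH0 DJk addrC mulNr.
  exact: (hk (Bseq Na, x) Kx).
rewrite (real_dist_linear ru (- a) sH0 (sJk k)) uJ0 addr0 normrM normrN (gtr0_norm a0).
rewrite mulrA [X in _ <= X]mulrC ler_pM2l// => hu; apply: le_trans hu _.
by rewrite mulrA ler_pdivrMr ?ltr_wpDl// mulrC ler_pM2l// lerDl.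
Qed.

End Consequences.
End RealDistributions.

(** * Bump functions *)

Section Bumps.
Context {R : realType}.

Lemma scaleRE (a b : R) : a *: b = a * b.
Proof. by []. Qed.

Lemma polynomial_le_exp (p : {poly R}) :
  exists C, forall y, 0 <= y -> `|p.[y]| <= C * expR y.
Proof.
exists (\sum_(i < size p) `|p`_i| * i.+1%:R ^+ i) => y y0.
rewrite horner_coef (le_trans (ler_norm_sum _ _ _))// mulr_suml ler_sum// => i _.
rewrite normrM -mulrA ler_wpM2l// normrX ger0_norm//.
have yE : y = i.+1%:R * (y / i.+1%:R) by rewrite mulrCA divff ?mulr1.
have y'0 : 0 <= y / i.+1%:R by rewrite divr_ge0.
rewrite {1}yE exprMn ler_wpM2l ?exprn_ge0//.
apply: (@le_trans _ _ (expR (y / i.+1%:R) ^+ i)).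
  by rewrite lerXn2r ?nnegrE ?expR_ge0// (le_trans _ (expR_ge1Dx _))// lerDr.
rewrite -expRM_natl ler_expR mulrCA ler_piMr//.
by rewrite ler_pdivrMr// mul1r ler_nat.
Qed.

(** The functions [p(1/x) exp(-1/x)], extended by [0]: a class containing
    [exp(-1/x)] that is stable under differentiation. *)
Definition flat (p : {poly R}) (x : R) : R :=
  if 0 < x then p.[x^-1] * expR (- x^-1) else 0.

(** Applied to ['X * p], this bound shows that the difference quotients of
    [flat p] at [0] tend to [0]. *)
Lemma flat_small p : exists C, forall x, `|flat p x| <= C * `|x|.
Proof.
have [C hC] := polynomial_le_exp (p * 'X).
have C0 : 0 <= C.
  by have := hC 0 (lexx 0); rewrite expR0 mulr1; exact: le_trans.
exists C => x; rewrite /flat; case: ifPn => [x0|_]; last by rewrite normr0 mulr_ge0.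
have := hC x^-1; rewrite invr_ge0 => /(_ (ltW x0)).
rewrite hornerM hornerX !normrM (gtr0_norm x0) (gtr0_norm (expR_gt0 _)).
rewrite normfV (gtr0_norm x0) ler_pdivrMr// expRN => h.
by rewrite ler_pdivrMr ?expR_gt0// mulrAC.
Qed.

Lemma is_derive_flat p (x : R) :
  is_derive x (1 : R) (flat p) (flat ('X^2 * (p - p^`())) x).
Proof.
have [x0|x0|->] := ltgtP x 0.
- rewrite [flat _ x]/flat (lt_gtF x0).
  apply: (near_eq_is_derive _ (is_derive_cst (0 : R) x (1 : R))).
  near=> y; rewrite /flat lt_gtF//; near: y.
  exact: lt_nbhsl.
- rewrite [flat _ x]/flat x0.
  have dV : is_derive x (1 : R) (fun y : R => y^-1) (- x ^- 2).
    have := @is_deriveV _ id x 1 1 (lt0r_neq0 x0) (is_derive_id _ _).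
    by rewrite [_ *: _]mulr1.
  have dp : is_derive x (1 : R) (fun y : R => p.[y^-1]) (p^`().[x^-1] * - x ^- 2).
    exact: (@is_derive1_comp _ (horner p) (fun y : R => y^-1) _ _ _ (is_derive_poly p _) dV).
  have de : is_derive x (1 : R) (fun y : R => expR (- y^-1)) (expR (- x^-1) * - - x ^- 2).
    exact: (@is_derive1_comp _ expR (fun y : R => - y^-1) _ _ _ (is_derive_expR _) (is_deriveN dV)).
  apply: (near_eq_is_derive (f := (fun y => p.[y^-1]) * (fun y => expR (- y^-1)))).
    near=> y; rewrite /flat ifT//; near: y; exact: lt_nbhsr.
  apply: is_derive_eq (is_deriveM dp de) _.
  rewrite hornerM hornerXn hornerD hornerN -exprVn !scaleRE; ring.
- rewrite [flat _ 0]/flat ltxx; have [C hC] := flat_small ('X * p).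
  have lim : h^-1 *: (flat p (h *: (1 : R) + 0) - flat p 0) @[h --> 0^'] --> (0 : R).
    have C1 : 0 < `|C| + 1 by rewrite ltr_wpDl.
    apply/cvgrPdist_le => e e0; near=> h.
    have h0 : h != 0 by near: h; exact: nbhs_dnbhs_neq.
    rewrite sub0r normrN addr0 [h *: _]mulr1 [X in _ - X]/flat ltxx subr0.
    have -> : h^-1 *: flat p h = flat ('X * p) h.
      rewrite /flat; case: ifPn => _; last by rewrite scaler0.
      by rewrite hornerM hornerX scaleRE mulrA.
    apply: le_trans (hC h) _; apply: (@le_trans _ _ ((`|C| + 1) * `|h|)).
      by rewrite ler_wpM2r// (le_trans (ler_norm _))// lerDl.
    rewrite mulrC -ler_pdivlMr//; near: h; apply: dnbhs0_le.
    by rewrite divr_gt0.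
  by split; [apply/cvg_ex; exists 0|exact: cvg_lim].
Unshelve. all: by end_near. Qed.

Lemma smooth_flat p : smooth_along (fun=> True) (flat p).
Proof.
apply: (@smooth_along_coind _ R _ (fun g => exists p, g = flat p)); last by exists p.
move=> _ [{}p ->]; have df x : derivable (flat p) x 1 by case: (is_derive_flat p x).
split=> [x|v _]; first exact/differentiable_continuous/derivable1_diffP.
have vE : v = v *: (1 : R) by rewrite [_ *: _]mulr1.
split=> [x|]; first by apply: diff_derivable; apply/derivable1_diffP.
exists (v *: ('X^2 * (p - p^`()))); apply/funext => x.
rewrite [in LHS]vE derive_dirZ// (@derive_val _ _ _ _ _ _ _ (is_derive_flat p x)).
by rewrite /flat; case: ifPn => _; rewrite ?mulr0// hornerZ mulrA.
Qed.

(** The factor [expR 2] normalizes the maximum, attained at [0] only, to [1]. *)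
Definition bell (x : R) : R := expR 2 * (flat 1 (x + 1) * flat 1 (- x + 1)).

Lemma smooth_bell : smooth_along (fun=> True) bell.
Proof.
have shift (a : R) : smooth_along (fun=> True) (fun x => flat 1 (a * x + 1)).
  apply: (smooth_along_comp (f := flat 1) (phi := fun x : R => a * x + 1)
    (L := fun v => a * v) (D' := fun=> True)) => //; last exact: smooth_flat.
    move=> x; apply: cvgD; last exact: cvg_cst.
    by apply: cvgMl_tmp; exact: cvg_id.
  by move=> v _; split=> // x t; rewrite !scaleRE; ring.
apply: smooth_alongZ; apply: smooth_alongM.
  have -> : (fun x => flat 1 (x + 1)) = fun x => flat 1 (1 * x + 1).
    by apply/funext => x; rewrite mul1r.
  exact: shift.
have -> : (fun x => flat 1 (- x + 1)) = fun x => flat 1 (-1 * x + 1).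
  by apply/funext => x; rewrite mulN1r.
exact: shift.
Qed.

Lemma bell_eq0 x : 1 <= `|x| -> bell x = 0.
Proof.
move=> x1; rewrite /bell /flat; case: ifPn => [h1|_]; last by rewrite mul0r mulr0.
case: ifPn => [h2|_]; last by rewrite !mulr0.
by move: x1; rewrite leNgt ltr_norml; case/negP; apply/andP; split; lra.
Qed.

Lemma bellE x : `|x| < 1 -> bell x = expR (- (2 * x ^+ 2 / (1 - x ^+ 2))).
Proof.
rewrite ltr_norml => /andP[x1 x2]; rewrite /bell /flat !ifT; [|lra|lra].
rewrite !hornerC !mul1r -!expRD; congr expR; field.
by apply/and3P; split; apply: lt0r_neq0; nra.
Qed.

Lemma bell_ge0 x : 0 <= bell x.
Proof.
have [/bell_eq0 -> //|/bellE ->] := leP 1 `|x|; exact: expR_ge0.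
Qed.

Lemma bell0 : bell 0 = 1.
Proof. by rewrite bellE ?normr0// expr0n mulr0 mul0r oppr0 expR0. Qed.

Lemma bell_lt1 x : x != 0 -> bell x < 1.
Proof.
move=> x0; have [/bell_eq0 -> //|x1] := leP 1 `|x|.
rewrite bellE// -[X in _ < X]expR0 ltr_expR oppr_lt0.
have : 0 < x ^+ 2 by rewrite exprn_even_gt0.
move=> x2; apply: divr_gt0; first by rewrite mulr_gt0.
move: x1; rewrite ltr_norml => /andP[h1 h2].
have : 0 < (1 - x) * (1 + x) by apply: mulr_gt0; lra.
by move=> h; rewrite -[X in X - _](expr1n R 2) subr_sqr.
Qed.

Lemma bell_le1 x : bell x <= 1.
Proof. by have [->|/bell_lt1/ltW//] := eqVneq x 0; rewrite bell0. Qed.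

End Bumps.

Section Cutoffs.
Context {R : realType}.

Lemma notin_sym_itv (A s : R) : ~ `[- A, A]%classic s -> A <= `|s|.
Proof.
move=> ns; apply: contrapT => /negP; rewrite -ltNge => /ltW sA; apply: ns.
by rewrite /= in_itv/= -ler_norml.
Qed.

Lemma continuous_maxr (T : topologicalType) (f g : T -> R) :
  continuous f -> continuous g -> continuous (fun x => Num.max (f x) (g x)).
Proof. by move=> cf cg x; exact: (@continuous_max R T f g x (cf x) (cg x)). Qed.

Lemma continuous_minr (T : topologicalType) (f g : T -> R) :
  continuous f -> continuous g -> continuous (fun x => Num.min (f x) (g x)).
Proof. by move=> cf cg x; exact: (@continuous_min R T f g x (cf x) (cg x)). Qed.

Lemma coord_norm_le n (x : 'rV[R]_n) i : `|x 0 i| <= `|x|.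
Proof.
rewrite [leRHS]/Num.Def.normr/= mx_normrE.
by apply: (le_bigmax _ (fun ij => `|x ij.1 ij.2|) (ord0, i)).
Qed.

Lemma continuous_distance (W : normedModType R) (x0 : W) :
  continuous (fun x => `|x - x0|).
Proof.
by move=> x; apply: cvg_norm; apply: cvgB; [exact: cvg_id|exact: cvg_cst].
Qed.

Lemma compact_norm_ball n (x0 : 'rV[R]_n) r : compact [set x | `|x - x0| <= r].
Proof.
apply: bounded_closed_compact.
  exists (r + `|x0|); split; [exact: num_real|move=> M rM x /= xr].
  rewrite -[x](subrK x0) (le_trans (ler_normD _ _))//.
  by apply: le_trans (ltW rM); rewrite lerD2r.
apply: (closed_comp (f := fun x : 'rV[R]_n => `|x - x0|) (D := [set y | y <= r])).
  by move=> x _; exact: continuous_distance.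
exact: closed_le.
Qed.

Lemma norm_bounded_Cc n (f : 'rV[R]_n -> R) A :
  continuous f -> (forall x, A <= `|x| -> f x = 0) -> Cc f.
Proof.
move=> cf fA; split=> //; exists [set x : 'rV[R]_n | `|x - 0| <= A].
  exact: compact_norm_ball.
by move=> x /=; rewrite subr0 => /negP; rewrite -ltNge => /ltW; exact: fA.
Qed.

Lemma smooth_coord n (g : R -> R) (i : 'I_n) (a b : R) :
  smooth_along (fun=> True) g ->
  smooth_along (fun=> True) (fun x : 'rV[R]_n => g (a * x 0 i + b)).
Proof.
move=> sg; have cphi : continuous (fun x : 'rV[R]_n => a * x 0 i + b).
  move=> x; exact: (cvgD (cvgM (cvg_cst a) (@coord_continuous R 1 n 0 i x)) (cvg_cst b)).
pose phi (x : 'rV[R]_n) : R := a * x 0 i + b.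
apply: (@smooth_along_comp R 'rV[R]_n R (fun=> True) (fun=> True) phi
  (fun v => a * v 0 i) g cphi) => //.
by move=> v _; split=> // x t; rewrite /phi !mxE scaleRE; ring.
Qed.

Lemma smooth_coordinate n (i : 'I_n) :
  smooth_along (fun=> True) (fun x : 'rV[R]_n => x 0 i).
Proof.
have sid : smooth_along (fun=> True) (id : R -> R).
  pose C (h : R -> R) := h = id \/ exists c, h = fun=> c.
  apply: (@smooth_along_coind R R _ C); last by left.
  move=> _ [->|[c ->]]; split.
  - by move=> x; exact: cvg_id.
  - move=> v _; split=> [x|]; first exact: derivable_id.
    by right; exists v; apply/funext => x; rewrite derive_id.
  - by move=> x; exact: cvg_cst.
  - move=> v _; split=> [x|]; first exact: derivable_cst.
    by right; exists 0; apply/funext => x; rewrite derive_cst.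
have := smooth_coord i 1 0 sid.
rewrite (_ : (fun x : 'rV[R]_n => id (1 * x 0 i + 0)) = fun x => x 0 i)//.
by apply/funext => x; rewrite /= mul1r addr0.
Qed.

(** A product of rescaled bells; it is strictly below [1] as soon as one
    coordinate differs from that of [x0]. *)
Lemma smooth_peak n (x0 : 'rV[R]_n) r : 0 < r -> exists tau : 'rV[R]_n -> R,
  [/\ smooth_along (fun=> True) tau, peak tau x0 &
      forall x, r <= `|x - x0| -> tau x = 0].
Proof.
move=> r0; pose tau (x : 'rV[R]_n) := \prod_(i < n) bell (r^-1 * x 0 i + - (r^-1 * x0 0 i)).
have argE (x : 'rV[R]_n) i : r^-1 * x 0 i + - (r^-1 * x0 0 i) = (x - x0) 0 i / r.
  by rewrite !mxE mulrBl mulrC [in RHS]mulrC; congr (_ - _); rewrite mulrC.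
have stau : smooth_along (fun=> True) tau.
  by apply: smooth_along_prod => i; apply: smooth_coord; exact: smooth_bell.
have tau0 x : r <= `|x - x0| -> tau x = 0.
  move=> xr; have [[i xi]|nx] := pselect (exists i, r <= `|(x - x0) 0 i|).
    rewrite /tau (bigD1 i)//= argE bell_eq0 ?mul0r//.
    by rewrite normrM normfV (gtr0_norm r0) ler_pdivlMr// mul1r.
  have nn : `|x - x0| != 0 by rewrite gt_eqF// (lt_le_trans r0).
  have [[a i]] := mx_norm_neq0 nn; rewrite ord1 /= => E.
  by exfalso; apply: nx; exists i; rewrite -E.
exists tau; split=> //; split.
- apply: (norm_bounded_Cc (A := r + `|x0|)); first exact: smooth_along_continuous stau.
  move=> x h; apply: tau0; rewrite -(lerD2r `|x0|); apply: le_trans h _.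
  by rewrite -[X in `|X| <= _](subrK x0) ler_normD.
- by move=> x; apply: prodr_ge0 => i _; exact: bell_ge0.
- by rewrite /tau big1// => i _; rewrite subrr bell0.
- move=> x xx0; have [i xi] : exists i, (x - x0) 0 i != 0.
    apply: contrapT => /forallNP h; move/eqP: xx0; apply; apply/rowP => i.
    by have /negP := h i; rewrite negbK !mxE subr_eq0 => /eqP.
  rewrite /tau (bigD1 i)//=; apply: (@le_lt_trans _ _ (bell ((x - x0) 0 i / r))).
    rewrite argE ler_piMr ?bell_ge0//; apply: prodr_ile1 => j _.
    by rewrite bell_ge0 bell_le1.
  by apply: bell_lt1; rewrite mulf_neq0// invr_eq0 gt_eqF.
Qed.

Lemma Cc_bell_opp : Cc (fun s : R => bell (- s)).
Proof.
split.
  move=> s; apply: (cvg_comp -%R bell); first exact: oppr_continuous.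
  exact: (smooth_along_continuous smooth_bell).
exists `[-1, 1]%classic; first exact: segment_compact.
by move=> s /notin_sym_itv s1; rewrite bell_eq0// normrN.
Qed.

Lemma integral_bell_opp_gt0 : 0 < line_integral (fun s : R => bell (- s)).
Proof.
apply: (radon_gt0 radon_line_integral Cc_bell_opp _ (w := 0)).
  by move=> s; exact: bell_ge0.
by rewrite oppr0 bell0.
Qed.

(** Convolution of a continuous trapezoid with a bell: on [[-A, A]] the bell only
    meets the part of height [1], and the result is the integral of the bell. *)
Lemma smooth_plateau (A : R) : exists2 chi : R -> R,
  smooth_along (fun=> True) chi & exists B, forall x,
  (`|x| <= A -> chi x = 1) /\ (B <= `|x| -> chi x = 0).
Proof.
pose kap (s : R) := Num.max 0 (Num.min 1 (A + 2 - `|s|)).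
have ckap : continuous kap.
  apply: continuous_maxr; first by move=> ?; exact: cvg_cst.
  apply: continuous_minr; first by move=> ?; exact: cvg_cst.
  by move=> s; exact: (cvgB (cvg_cst (A + 2)) (@norm_continuous R R s)).
pose h (z : R * R) := kap z.2 * bell (z.1 - z.2).
have sh : smooth_along (@along1 R R R) h.
  apply: smooth_alongM.
    apply: smooth_along_inv.
      by move=> z; apply: (cvg_comp snd kap); [exact: cvg_snd|exact: ckap].
    by move=> v v2 z t /=; rewrite v2 scaler0 add0r.
  apply: (smooth_along_comp (f := bell) (phi := fun z : R * R => z.1 - z.2)
    (L := fun v => v.1) (D' := fun=> True)); last exact: smooth_bell.
    by move=> z; apply: cvgB; [exact: cvg_fst|exact: cvg_snd].
  by move=> v v2; split=> // z t /=; rewrite v2 scaler0 add0r addrA.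
have fh : fiber_Cc h.
  move=> x0; exists `[- (A + 2), A + 2]%classic; first exact: segment_compact.
  apply: filterE => x s ns; rewrite /h /kap/= max_l ?mul0r//.
  rewrite ge_min; apply/orP; right; rewrite subr_le0.
  exact: notin_sym_itv.
pose f (s : R) := bell (- s); have cf : Cc f by exact: Cc_bell_opp.
pose c := line_integral f; have c0 : 0 < c by exact: integral_bell_opp_gt0.
exists (fun x => c^-1 * line_integral (fun s => h (x, s))).
  by apply/smooth_alongZ/smooth_realE; exact: (radon_param_smooth radon_line_integral).
exists (`|A| + 3) => x; split=> xA.
  suff -> : line_integral (fun s => h (x, s)) = c by rewrite mulVf ?gt_eqF.
  rewrite /c -(line_integral_transl (- x) cf); congr line_integral; apply/funext => s.
  rewrite /h /f /= opprD opprK.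
  have [xs|xs] := leP 1 `|x - s|; first by rewrite bell_eq0// mulr0.
  rewrite /kap min_l ?max_r ?mul1r//.
  have := ler_dist_dist s x; rewrite distrC.
  have := ler_norm (`|s| - `|x|); lra.
suff -> : (fun s => h (x, s)) = fun=> 0 by rewrite (radon0 radon_line_integral) mulr0.
apply/funext => s; rewrite /h /=.
have [xs|xs] := leP 1 `|x - s|; first by rewrite bell_eq0// mulr0.
rewrite /kap max_l ?mul0r//; rewrite ge_min; apply/orP; right.
have := ler_norm (`|x| - `|s|); have := ler_dist_dist x s; have := ler_norm A; lra.
Qed.

Lemma smooth_cutoff n (A : R) : exists2 rho : 'rV[R]_n -> R,
  smooth_along (fun=> True) rho & exists B, forall x,
  (`|x| <= A -> rho x = 1) /\ (B <= `|x| -> rho x = 0).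
Proof.
have [chi schi [B hB]] := smooth_plateau A.
exists (fun x => \prod_(i < n) chi (1 * x 0 i + 0)).
  by apply: smooth_along_prod => i; exact: smooth_coord.
exists (`|B| + 1) => x; split=> xA.
  rewrite big1// => i _; rewrite mul1r addr0; apply: (proj1 (hB _)).
  exact: le_trans (coord_norm_le _ _) xA.
have nn : `|x| != 0 by rewrite gt_eqF// (lt_le_trans _ xA)// ltr_wpDl.
have [[a i]] := mx_norm_neq0 nn; rewrite ord1 /= => E.
rewrite (bigD1 i)//= mul1r addr0 (proj2 (hB _)) ?mul0r// -E.
by apply: le_trans xA; rewrite (le_trans (ler_norm _))// lerDl.
Qed.

(** Its powers are the Landau kernels, polynomials on [[-M, M]]. *)
Lemma parabola_peak (M : R) : 0 < M ->
  peak (fun s : R => Num.max 0 (1 - s ^+ 2 / M ^+ 2)) 0.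
Proof.
move=> M0; have M20 : 0 < M ^+ 2 by rewrite exprn_gt0.
split.
- split.
    apply: continuous_maxr; first by move=> ?; exact: cvg_cst.
    move=> s; apply: cvgB; first exact: cvg_cst.
    by apply: cvgMr_tmp; exact: exprn_continuous.
  exists `[- M, M]%classic; first exact: segment_compact.
  move=> s ns; rewrite max_l// subr_le0 ler_pdivlMr// mul1r -(real_normK (num_real s)).
  rewrite lerXn2r ?nnegrE ?(ltW M0)//.
  exact: notin_sym_itv.
- by move=> s; rewrite le_max lexx.
- by rewrite expr0n mul0r subr0 max_r.
- move=> s s0; rewrite gt_max ltr01/= ltrBlDr ltrDl divr_gt0//.
  by rewrite exprn_even_gt0.
Qed.

End Cutoffs.

(** * The ray transform and its adjoint *)

Section RayTransform.
Context {R : realType} {n : nat}.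
Notation V := 'rV[R]_n.

(** The support condition is stated with an arbitrary compact set instead of the
    closure of the non-vanishing locus; it is then visibly stable under
    differentiation. *)
Record ray_test (psi : V * V -> R) : Prop := RayTest {
  ray_test_smooth : smooth_along (fun=> True) psi;
  ray_test_support : exists S : set (V * V),
    [/\ compact S, forall z, S z -> z.2 != 0 & vanish_off S psi] }.

Definition ray_functional (f : V * R -> R) : R :=
  space_integral (fun xi => line_integral (fun t => f (xi, t))).

Lemma radon_ray_functional : radon ray_functional.
Proof. exact: radon_prod (radon_space_integral n) radon_line_integral. Qed.

Definition ray_integrand k (P : V -> R) (psi : V * V -> R) (z : V * (V * R)) : R :=
  z.2.2 ^+ k * P z.2.1 * psi (z.1 - z.2.2 *: z.2.1, z.2.1).

(** The general weight [P] stands for the monomials [xi^i] and for their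
    derivatives, which appear when one integrates by parts. *)
Definition ray_adjoint k P psi (x : V) : R :=
  ray_functional (fun w => ray_integrand k P psi (x, w)).

Lemma fst_continuous (U W : normedModType R) : continuous (@fst U W).
Proof. by move=> z; exact: cvg_fst. Qed.

Lemma snd_continuous (U W : normedModType R) : continuous (@snd U W).
Proof. by move=> z; exact: cvg_snd. Qed.

Lemma continuous_directions : continuous (fun z : V * (V * R) => z.2.1).
Proof.
move=> z; exact: (cvg_comp _ _ (@snd_continuous V (V * R)%type z) (@fst_continuous V R z.2)).
Qed.

Lemma continuous_shear : continuous (fun z : V * (V * R) => z.1 - z.2.2 *: z.2.1).
Proof.
move=> z; have ct : (fun z : V * (V * R) => z.2.2) @ z --> z.2.2.
  exact: (cvg_comp _ _ (@snd_continuous V (V * R)%type z) (@snd_continuous V R z.2)).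
have cz : (fun z : V * (V * R) => z.2.2 *: z.2.1) @ z --> z.2.2 *: z.2.1.
  exact: (cvgZ ct (@continuous_directions z)).
exact: (cvgB (@fst_continuous V (V * R)%type z) cz).
Qed.

Lemma smooth_ray_integrand k P psi : continuous P -> smooth_along (fun=> True) psi ->
  smooth_along (@along1 R V (V * R)%type) (ray_integrand k P psi).
Proof.
move=> cP spsi; apply: smooth_alongM.
  apply: smooth_along_inv; last by move=> v v2 z t; rewrite /= v2 /= !scaler0 !add0r.
  have cw : continuous (fun w : V * R => w.2 ^+ k * P w.1).
    move=> w; have c1 := cvg_comp fst P (@fst_continuous V R w) (cP w.1).
    have c2 := cvg_comp snd (fun t : R => t ^+ k) (@snd_continuous V R w)
      (@exprn_continuous R k w.2).
    exact: (cvgM c2 c1).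
  by move=> z; exact: (cvg_comp _ _ (@snd_continuous V (V * R)%type z) (cw z.2)).
pose phi (z : V * (V * R)) := (z.1 - z.2.2 *: z.2.1, z.2.1).
have cphi : continuous phi.
  by move=> z; exact: (cvg_pair (@continuous_shear z) (@continuous_directions z)).
apply: (@smooth_along_comp R (V * (V * R))%type (V * V)%type (@along1 R V _)
  (fun=> True) phi (fun v => (v.1, 0)) psi cphi) => // v v2.
split=> // z t; rewrite /phi /= v2 /= !scaler0 !add0r; congr pair; last by rewrite /= scaler0 add0r.
by rewrite /= addrA.
Qed.

Lemma compact_norm_lb (S : set (V * V)) : compact S -> (forall z, S z -> z.2 != 0) ->
  exists2 c, 0 < c & forall z, S z -> c <= `|z.2|.
Proof.
move=> /compact_near_coveringP cS S0.
have : \forall c \near (0 : R)^'+, S `<=` (fun z => c <= `|z.2|).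
  apply: cS => z Sz; have z0 : 0 < `|z.2| by rewrite normr_gt0 S0.
  exists ([set w | `|z.2| / 2 < `|w.2|], [set c | c <= `|z.2| / 2]) => /=.
    split; last by apply: nbhs_right_le; rewrite divr_gt0.
    have h : `|z.2| / 2 < `|z.2| by lra.
    exact: (cvgr_gt _ (cvg_norm (@snd_continuous V V z)) _ h).
  by move=> [w c] /= [wz cz]; exact: le_trans cz (ltW wz).
move=> hc; near (0 : R)^'+ => c; exists c => //; near: c; exact: hc.
Unshelve. all: by end_near. Qed.

Lemma near_norm_lt (x0 : V) : \forall x \near nbhs x0, `|x| < `|x0| + 1.
Proof.
have h : `|x0| < `|x0| + 1 by rewrite ltrDl.
exact: (cvgr_lt _ (@norm_continuous _ _ x0) _ h).
Qed.

(** The support of [psi] stays away from [xi = 0], so that a ray through a bounded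
    set meets it only for bounded [t]. *)
Lemma fiber_Cc_ray_integrand k P psi : ray_test psi ->
  fiber_Cc (ray_integrand k P psi).
Proof.
case=> _ [S [cS S0 Spsi]] x0; have [c c0 hc] := compact_norm_lb cS S0.
have [B B0 SB] := pinfty_ex_gt0 (compact_bounded cS).
pose T := (`|x0| + 1 + B) / c.
exists ((snd @` S) `*` `[- T, T]%classic).
  by apply: compact_setX; [exact: compact_snd|exact: segment_compact].
apply: filterS (near_norm_lt x0) => x xx0 [xi t] /= nxi.
rewrite /ray_integrand /= Spsi ?mulr0// => Sz; apply: nxi; split; first by exists (x - t *: xi, xi).
rewrite /= in_itv/= -ler_norml /T ler_pdivlMr//.
apply: (@le_trans _ _ (`|t| * `|xi|)); first by rewrite ler_wpM2l//; exact: hc Sz.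
rewrite -normrZ -[t *: xi](subKr x) (le_trans (ler_normB _ _))// lerD ?(ltW xx0)//.
by apply: le_trans _ (SB _ Sz); rewrite prod_normE le_max lexx.
Qed.

Lemma smooth_ray_adjoint k P psi : continuous P -> ray_test psi ->
  smooth_real (ray_adjoint k P psi).
Proof.
move=> cP tpsi; apply: (radon_param_smooth radon_ray_functional).
  by apply: smooth_ray_integrand => //; exact: ray_test_smooth.
exact: fiber_Cc_ray_integrand.
Qed.

Lemma Cc_ray_integrand k P psi x : continuous P -> ray_test psi ->
  Cc (fun w => ray_integrand k P psi (x, w)).
Proof.
move=> cP tpsi; apply: fiber_Cc_Cc; last exact: fiber_Cc_ray_integrand.
by apply/smooth_along_continuous/smooth_ray_integrand => //; exact: ray_test_smooth.
Qed.

(** A point of a line in a direction of length at least [r] stays in a bounded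
    set only for bounded values of the line parameter. *)
Lemma ray_leaves_ball (x xi : V) t A r : r <= `|xi| -> A + `|x| <= `|t| * r ->
  A <= `|x - t *: xi|.
Proof.
move=> rxi h; have : `|t| * r <= `|t *: xi| by rewrite normrZ ler_wpM2l.
have := ler_normB x (x - t *: xi); rewrite subKr.
have := normr_ge0 x; lra.
Qed.

End RayTransform.

(** * Injectivity on scalar distributions *)

Section ScalarCase.
Context {R : realType} {n : nat}.
Notation V := 'rV[R]_n.
Variables (u : (V -> R) -> R) (ru : real_dist u).

Definition ray_average (a : V -> R) (xi x : V) : R :=
  line_integral (fun t => a (x - t *: xi)).

Lemma continuous_line (xi : V) : continuous (fun z : V * R => z.1 - z.2 *: xi).
Proof.
move=> z; have cz : (fun z : V * R => z.2 *: xi) @ z --> z.2 *: xi.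
  by apply: cvgZr_tmp; exact: cvg_snd.
exact: (cvgB (@fst_continuous R V R z) cz).
Qed.

Lemma smooth_ray_average a xi A : smooth_along (fun=> True) a ->
  (forall x, A <= `|x| -> a x = 0) -> xi != 0 -> smooth_real (ray_average a xi).
Proof.
move=> sa aA xi0; have nxi : 0 < `|xi| by rewrite normr_gt0.
pose h (z : V * R) := a (z.1 - z.2 *: xi).
apply: (radon_param_smooth radon_line_integral (h := h)).
  apply: (@smooth_along_comp R (V * R)%type V _ (fun=> True) _ (fun v => v.1) a
    (@continuous_line xi)) => // v v2.
  by split=> // z t; rewrite /= v2 scaler0 add0r addrA.
move=> x0; pose T := (`|A| + (`|x0| + 1)) / `|xi|.
exists `[- T, T]%classic; first exact: segment_compact.
apply: filterS (near_norm_lt x0) => x xx0 t nt; apply: aA.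
apply: (ray_leaves_ball (lexx _)); rewrite -ler_pdivrMr//.
apply: le_trans (notin_sym_itv nt); rewrite ler_pM2r ?invr_gt0// lerD ?ler_norm//.
exact: ltW.
Qed.

(** The test functions [a(x) tau(xi)^(k+2)], with [tau] peaking at the chosen
    direction, localize the ray transform to that direction. *)
Lemma ray_average_annihilated a xi0 A :
  (forall psi, ray_test psi -> u (ray_adjoint 0 (fun=> 1) psi) = 0) ->
  smooth_along (fun=> True) a -> (forall x, A <= `|x| -> a x = 0) -> xi0 != 0 ->
  u (ray_average a xi0) = 0.
Proof.
move=> uI sa aA xi00; have nxi : 0 < `|xi0| by rewrite normr_gt0.
(* A support of radius [|xi0| / 2] keeps [tau] away from the direction [0]. *)
pose r := `|xi0| / 2; have r0 : 0 < r by rewrite divr_gt0.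
have [tau [stau ptau taur]] := smooth_peak xi0 r0.
have tau_far xi : tau xi != 0 -> r <= `|xi|.
  move=> txi; have : `|xi - xi0| < r.
    by rewrite ltNge; apply/negP => /taur /eqP; apply/negP.
  have := ler_normB xi (xi - xi0); rewrite subKr /r; lra.
pose h (z : (V * V) * R) := tau z.1.2 * a (z.1.1 - z.2 *: z.1.2).
have c11 : continuous (fun z : (V * V) * R => z.1.1).
  move=> z; exact: (cvg_comp _ _ (@fst_continuous R (V * V)%type R z)
    (@fst_continuous R V V z.1)).
have c12 : continuous (fun z : (V * V) * R => z.1.2).
  move=> z; exact: (cvg_comp _ _ (@fst_continuous R (V * V)%type R z)
    (@snd_continuous R V V z.1)).
have cline : continuous (fun z : (V * V) * R => z.1.1 - z.2 *: z.1.2).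
  move=> z; have cz : (fun z : (V * V) * R => z.2 *: z.1.2) @ z --> z.2 *: z.1.2.
    exact: (cvgZ (@snd_continuous R (V * V)%type R z) (c12 z)).
  exact: (cvgB (c11 z) cz).
have ctau := smooth_along_continuous stau.
have sh : smooth_along (fun z : (V * V) * R => @along1 R V V z.1 /\ z.2 = 0) h.
  apply: smooth_alongM.
    apply: smooth_along_inv; first by move=> z; exact: (cvg_comp _ _ (c12 z) (ctau _)).
    by move=> v [v12 _] z t; rewrite /= v12 scaler0 add0r.
  apply: (@smooth_along_comp R ((V * V) * R)%type V _ (fun=> True) _ (fun v => v.1.1) a
    cline) => // v [v12 v2].
  by split=> // z t; rewrite /= v12 v2 !scaler0 !add0r addrA.
have fh : fiber_Cc h.
  move=> [x0 xi1]; pose T := (`|A| + (`|x0| + 1)) / r.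
  exists `[- T, T]%classic; first exact: segment_compact.
  exists ([set x | `|x| < `|x0| + 1], setT) => /=.
    by split; [exact: near_norm_lt|exact: filterT].
  move=> [x xi] /= [xx0 _] t nt; rewrite /h /=.
  have [->|txi] := eqVneq (tau xi) 0; first by rewrite mul0r.
  rewrite aA ?mulr0//; apply: (ray_leaves_ball (tau_far _ txi)); rewrite -ler_pdivrMr//.
  apply: le_trans (notin_sym_itv nt); rewrite ler_pM2r ?invr_gt0// lerD ?ler_norm//.
  exact: ltW.
have ch : continuous h := smooth_along_continuous sh.
pose H (z : V * V) := line_integral (fun t => h (z, t)).
have sH : smooth_along (@along1 R V V) H.
  exact: (radon_param_smooth_along radon_line_integral sh fh).
have -> : ray_average a xi0 = fun x => H (x, xi0).
  apply/funext => x; congr line_integral; apply/funext => t.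
  by rewrite /h /= (peak_max ptau) mul1r.
apply: (real_dist_concentration ru (radon_space_integral n) ptau sH) => k.
pose psi (z : V * V) := tau z.2 ^+ k.+2 * a z.1.
rewrite -[RHS](uI psi); last first.
  split.
    apply: smooth_alongM.
      apply: smooth_alongX.
      apply: (@smooth_along_comp R (V * V)%type V _ (fun=> True) snd snd tau
        (@snd_continuous R V V)) => //.
    apply: (@smooth_along_comp R (V * V)%type V _ (fun=> True) fst fst a
      (@fst_continuous R V V)) => //.
  exists ([set x | `|x - 0| <= `|A|] `*` [set xi | `|xi - xi0| <= r]); split.
  - by apply: compact_setX; exact: compact_norm_ball.
  - move=> [x xi] [/= _ h2]; apply/negP => /eqP xi_eq.
    by move: h2; rewrite xi_eq sub0r normrN /r; lra.
  - move=> [x xi] /= nz; rewrite /psi /=.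
    have [xA|xA] := leP A `|x|; first by rewrite aA// mulr0.
    rewrite taur ?expr0n ?mul0r// leNgt; apply/negP => xir; apply: nz; split=> /=; rewrite ?subr0.
      by apply: le_trans (ltW xA) _; exact: ler_norm.
    exact: ltW.
congr u; apply/funext => x; rewrite /ray_adjoint /ray_functional; congr space_integral.
apply/funext => xi; rewrite /H -(radonZ radon_line_integral); last exact: fiber_Cc_Cc.
congr line_integral; apply/funext => t.
by rewrite /ray_integrand /h /psi /= expr0 mulr1 mul1r [tau xi ^+ k.+2]exprSr mulrA.
Qed.

Hypothesis averages0 : forall a A xi, smooth_along (fun=> True) a ->
  (forall x, A <= `|x| -> a x = 0) -> xi != 0 -> u (ray_average a xi) = 0.

(** With [a = phi h(x_j) rho], where [h] is a bell and [rho] a cutoff equal to [1]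
    on a large ball, the ray average of [a] is a constant multiple of [phi] on the
    ball that [u] sees: [phi] and [rho] are constant along the relevant part of
    the ray, which [h] keeps bounded. *)
Lemma ray_invariant_annihilated phi (xi : V) j : smooth_along (fun=> True) phi ->
  xi 0 j = 1 -> (forall x t, phi (x - t *: xi) = phi x) -> u phi = 0.
Proof.
move=> sphi xij phi_inv; have [A A0 uloc] := real_dist_local ru.
(* For [|x| < A] the bell forces [|t| < A + 1]. *)
have [rho srho [B hB]] := @smooth_cutoff R n (A + (A + 1) * `|xi|).
have xi0 : xi != 0.
  by apply/eqP => xi0; move: xij; rewrite xi0 mxE => /esym /eqP; rewrite oner_eq0.
pose a x := phi x * (bell (1 * x 0 j + 0) * rho x).
have sa : smooth_along (fun=> True) a.
  do 2 apply: smooth_alongM => //; apply: smooth_coord; exact: smooth_bell.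
have aB x : B <= `|x| -> a x = 0 by move=> /(hB x).2; rewrite /a => ->; rewrite !mulr0.
pose f (s : R) := bell (- s); have cf : Cc f by exact: Cc_bell_opp.
pose c := line_integral f; have c0 : 0 < c by exact: integral_bell_opp_gt0.
have avgE x : `|x| < A -> ray_average a xi x = c * phi x.
  move=> xA; rewrite mulrC /c -(line_integral_transl (- x 0 j) cf).
  rewrite -(radonZ radon_line_integral); last exact: Cc_transl.
  congr line_integral; apply/funext => t; rewrite /a phi_inv; congr (_ * _).
  have -> : 1 * (x - t *: xi) 0 j + 0 = - (- x 0 j + t).
    by rewrite !mxE xij; ring.
  rewrite /f; have [h|h] := leP 1 `|- x 0 j + t|.
    by rewrite bell_eq0 ?mul0r// normrN.
  rewrite (proj1 (hB _)) ?mulr1//.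
  apply: (le_trans (ler_normB _ _)); rewrite normrZ lerD ?(ltW xA)// ler_wpM2r//.
  have := ler_normD (x 0 j) (- x 0 j + t); rewrite addNKr.
  have := coord_norm_le x j; lra.
have : u (ray_average a xi) = u (fun x => c * phi x).
  apply: uloc => //; first exact: smooth_ray_average sa aB xi0.
  by apply: smooth_realZ; exact/smooth_realE.
rewrite (averages0 sa aB xi0) (real_distZ ru)//; last exact/smooth_realE.
by move/esym/eqP; rewrite mulf_eq0 gt_eqF//= => /eqP.
Qed.

(** The function [(x_i + l x_j)^d g(x)] is invariant along [e_j - l e_i], hence
    annihilated for every [l]; as a polynomial in [l], all its coefficients are. *)
Lemma monomial_annihilated i j g a b : i != j -> smooth_along (fun=> True) g ->
  (forall x s t, g (x + (s *: delta_mx 0 i + t *: delta_mx 0 j)) = g x) ->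
  u (fun x => x 0 i ^+ a * x 0 j ^+ b * g x) = 0.
Proof.
move=> ij sg g_inv; pose d := (a + b)%N.
pose m k (x : V) := x 0 i ^+ (d - k) * x 0 j ^+ k * g x.
have scoord l : smooth_along (fun=> True) (fun x : V => x 0 l) by exact: smooth_coordinate.
have sm k : smooth_real (m k).
  by apply/smooth_realE; do 2 apply: smooth_alongM => //; exact: smooth_alongX.
pose p := \poly_(k < d.+1) ('C(d, k)%:R * u (m k)).
have p0 l : p.[l] = 0.
  pose xi : V := delta_mx 0 j - l *: delta_mx 0 i.
  have xij : xi 0 j = 1 by rewrite !mxE !eqxx [j == i]eq_sym (negbTE ij) /= mulr0 subr0.
  have xii : xi 0 i = - l.
    by rewrite !mxE !eqxx (negbTE ij) /= mulr1 sub0r.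
  pose phi (x : V) := (x 0 i + l * x 0 j) ^+ d * g x.
  have sphi : smooth_along (fun=> True) phi.
    apply: smooth_alongM => //; apply: smooth_alongX; apply: smooth_alongD => //.
    exact: smooth_alongZ.
  have phi_inv x t : phi (x - t *: xi) = phi x.
    rewrite /phi; congr (_ ^+ _ * _).
      have -> : (x - t *: xi) 0 i = x 0 i - t * xi 0 i by rewrite !mxE.
      have -> : (x - t *: xi) 0 j = x 0 j - t * xi 0 j by rewrite !mxE.
      by rewrite xii xij; ring.
    rewrite -[RHS](g_inv x (t * l) (- t)); congr g; congr (_ + _).
    by rewrite /xi scalerBr scalerA opprB scaleNr.
  rewrite -(ray_invariant_annihilated sphi xij phi_inv).
  have -> : phi = fun x => \sum_(k < d.+1) ('C(d, k)%:R * l ^+ k) * m k x.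
    apply/funext => x; rewrite /phi exprDn mulr_suml; apply: eq_bigr => k _.
    by rewrite /m exprMn -mulr_natr; ring.
  rewrite (real_dist_sum ru); last by move=> k; exact: smooth_realZ.
  rewrite horner_poly; apply: eq_bigr => k _.
  by rewrite (real_distZ ru)// mulrAC.
have pz : p = 0.
  apply/eqP; apply/negPn/negP => pn0.
  have roots : all (root p) [seq k%:R | k <- iota 0 (size p)].
    by apply/allP => _ /mapP[k _ ->]; rewrite /root p0.
  have uniq_roots : uniq [seq k%:R : R | k <- iota 0 (size p)].
    by rewrite map_inj_uniq ?iota_uniq// => k k' /eqP; rewrite eqr_nat => /eqP.
  by have := max_poly_roots pn0 roots uniq_roots; rewrite size_map size_iota ltnn.
have := congr1 (fun q : {poly R} => q`_b) pz.
rewrite coef_poly coef0 ltnS /d leq_addl => /eqP.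
rewrite mulf_eq0 pnatr_eq0 -leqn0 leqNgt bin_gt0 leq_addl/= => /eqP.
by rewrite /m /d addnK.
Qed.

Definition set_coord i (x : V) (s : R) : V := x + (s - x 0 i) *: delta_mx 0 i.

Lemma continuous_set_coord i : continuous (fun z : V * R => set_coord i z.1 z.2).
Proof.
apply: continuous_rV => l.
have -> : (fun z : V * R => set_coord i z.1 z.2 0 l) =
    fun z : V * R => z.1 0 l + (z.2 - z.1 0 i) * (l == i)%:R.
  by apply/funext => z; rewrite !mxE eqxx.
move=> z.
have cc k : (fun z : V * R => z.1 0 k) @ z --> z.1 0 k.
  exact: (cvg_comp _ _ (@fst_continuous R V R z) (@coord_continuous R 1 n 0 k z.1)).
have c1 : (fun z : V * R => z.2 - z.1 0 i) @ z --> z.2 - z.1 0 i.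
  exact: (cvgB (@snd_continuous R V R z) (cc i)).
have c2 : (fun z : V * R => (z.2 - z.1 0 i) * (l == i)%:R) @ z -->
    (z.2 - z.1 0 i) * (l == i)%:R by exact: cvgMr_tmp.
exact: (cvgD (cc l) c2).
Qed.

Definition coord_average i (c : R -> R) phi (x : V) : R :=
  line_integral (fun s => c s * phi (set_coord i x s)).

Lemma coord_average_fiber i c phi : Cc c ->
  fiber_Cc (fun z : V * R => c z.2 * phi (set_coord i z.1 z.2)).
Proof.
move=> [_ [K cK Kc]] x0; exists K => //.
by apply: filterE => x s ns; rewrite /= Kc// mul0r.
Qed.

Lemma smooth_coord_average_param i c phi : Cc c -> smooth_along (fun=> True) phi ->
  smooth_along (@along1 R V R) (fun z : V * R => c z.2 * phi (set_coord i z.1 z.2)).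
Proof.
move=> cc sphi; apply: smooth_alongM.
  apply: smooth_along_inv; last by move=> v v2 z t; rewrite /= v2 scaler0 add0r.
  by move=> z; exact: (cvg_comp _ _ (@snd_continuous R V R z) (Cc_continuous cc (x := z.2))).
apply: (@smooth_along_comp R (V * R)%type V _ (fun=> True) _
  (fun v => v.1 - v.1 0 i *: delta_mx 0 i) phi (@continuous_set_coord i)) => // v v2.
split=> // z t; rewrite /set_coord /= v2 scaler0 add0r; apply/rowP => l.
by rewrite !mxE; ring.
Qed.

Lemma smooth_coord_average i c phi : Cc c -> smooth_along (fun=> True) phi ->
  smooth_along (fun=> True) (coord_average i c phi).
Proof.
move=> cc sphi; apply/smooth_realE.
apply: (radon_param_smooth radon_line_integral
  (h := fun z => c z.2 * phi (set_coord i z.1 z.2))).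
  exact: smooth_coord_average_param.
exact: coord_average_fiber.
Qed.

Lemma Cc_coord_average i c phi x : Cc c -> continuous phi ->
  Cc (fun s => c s * phi (set_coord i x s)).
Proof.
move=> cc cphi; under eq_fun do rewrite mulrC; apply: CcM => // s.
have c1 := cvg_comp _ _ (@continuous_pairr R V R x s) (@continuous_set_coord i (x, s)).
exact: (cvg_comp _ _ c1 (cphi _)).
Qed.

(** A one-variable Weierstrass theorem for all derivatives at once: averaging
    along [e_i] against the powers of [1 - s^2 / M^2] turns a function into a
    polynomial in [x_i] with coefficients independent of [x_i]. *)
Lemma coord_density i phi : smooth_along (fun=> True) phi ->
  (forall a c, Cc c -> u (fun x => x 0 i ^+ a * coord_average i c phi x) = 0) ->
  u phi = 0.
Proof.
move=> sphi u0; have [A A0 uloc] := real_dist_local ru.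
have [chi schi [B hB]] := @smooth_plateau R A.
have cchi := smooth_along_continuous schi.
(* For [|x| < A] and [|x_i + s| < B] one has [|s| <= M], the range on which the
   kernel is a polynomial. *)
pose M := A + `|B|; have M0 : 0 < M by rewrite ltr_pwDl.
have ptau := parabola_peak M0; set tau := (fun s => Num.max _ _) in ptau.
pose phic (x : V) := chi (1 * x 0 i + 0) * phi x.
have sphic : smooth_along (fun=> True) phic.
  by apply: smooth_alongM => //; exact: smooth_coord.
have -> : u phi = u phic.
  apply: uloc; [exact/smooth_realE|exact/smooth_realE|].
  move=> x xA; rewrite /phic mul1r addr0 (proj1 (hB _)) ?mul1r//.
  exact: le_trans (coord_norm_le _ _) (ltW xA).
pose H (z : V * R) := phic (z.1 + z.2 *: delta_mx 0 i).
have cline : continuous (fun z : V * R => z.1 + z.2 *: delta_mx 0 i : V).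
  have -> : (fun z : V * R => z.1 + z.2 *: delta_mx 0 i) =
      fun z : V * R => z.1 - z.2 *: - delta_mx 0 i.
    by apply/funext => z; rewrite scalerN opprK.
  exact: continuous_line.
have sH : smooth_along (@along1 R V R) H.
  apply: (@smooth_along_comp R (V * R)%type V _ (fun=> True) _ (fun v => v.1) phic
    cline) => // v v2.
  by split=> // z t; rewrite /= v2 scaler0 add0r addrA.
have -> : phic = fun x => H (x, 0).
  by apply/funext => x; rewrite /H /= scale0r addr0.
apply: (real_dist_concentration ru radon_line_integral ptau sH) => k.
(* Taylor expansion of [Q] at [s] separates [x_i] from [s] in [Q (s - x_i)]. *)
pose Q : {poly R} := (1 - (M ^- 2) *: 'X^2) ^+ k.+1.
have QE s : Q.[s] = (1 - s ^+ 2 / M ^+ 2) ^+ k.+1.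
  by rewrite /Q horner_exp hornerD hornerN hornerZ hornerXn hornerC [_ / _]mulrC.
have cpoly (q : {poly R}) : Cc (fun s => q.[s] * chi s).
  apply: CcM; first by move=> s; exact: continuous_horner.
  split=> //; exists `[- `|B|, `|B|]%classic; first exact: segment_compact.
  move=> s ns; apply: (proj2 (hB s)); exact: le_trans (ler_norm _) (notin_sym_itv ns).
pose term (a : nat) (x : V) : R := (-1) ^+ a *
  (x 0 i ^+ a * coord_average i (fun s : R => (Q^`N(a)).[s] * chi s) phi x).
have sterm a : smooth_real (term a).
  apply/smooth_realE/smooth_alongZ/smooth_alongM; last exact: smooth_coord_average.
  by apply: smooth_alongX; exact: smooth_coordinate.
transitivity (u (fun x => \sum_(a < size Q) term a x)).
  apply: uloc.
  - exact: (smooth_peak_average radon_line_integral ptau k sH).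
  - by apply/smooth_realE/smooth_along_sum => a; exact/smooth_realE.
  move=> x xA.
  pose f s := Q.[s - x 0 i] * (chi s * phi (set_coord i x s)).
  have cf : Cc f.
    have -> : f = fun s => (Q \Po ('X - (x 0 i)%:P)).[s] * chi s * phi (set_coord i x s).
      by apply/funext => s; rewrite /f horner_comp hornerXsubC mulrA.
    by apply: Cc_coord_average => //; exact: smooth_along_continuous sphi.
  transitivity (line_integral f).
    rewrite -(line_integral_transl (x 0 i) cf); congr line_integral; apply/funext => s.
    rewrite /f /H /phic /= QE.
    have -> : 1 * (x + s *: delta_mx 0 i) 0 i + 0 = x 0 i + s.
      by rewrite !mxE !eqxx /=; ring.
    have -> : x 0 i + s - x 0 i = s by ring.
    have -> : set_coord i x (x 0 i + s) = x + s *: delta_mx 0 i.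
      by rewrite /set_coord addrAC subrr add0r.
    have [xs|xs] := leP B `|x 0 i + s|.
      by rewrite (proj2 (hB _) xs) !mul0r !mulr0.
    congr (_ ^+ _ * _); rewrite /tau max_r// subr_ge0.
    rewrite ler_pdivrMr ?exprn_gt0// mul1r -(real_normK (num_real s)).
    rewrite lerXn2r ?nnegrE ?(ltW M0)// /M.
    have := ler_normB (x 0 i + s) (x 0 i); rewrite addrAC subrr add0r.
    have := coord_norm_le x i; have := ler_norm B; lra.
  have fE : f = fun s => \sum_(a < size Q) (- x 0 i) ^+ a *
      ((Q^`N(a)).[s] * chi s * phi (set_coord i x s)).
    apply/funext => s; rewrite /f nderiv_taylor; last exact: mulrC.
    rewrite mulr_suml; apply: eq_bigr => a _; ring.
  rewrite fE (radon_sum radon_line_integral); last first.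
    move=> a; apply/CcZ/Cc_coord_average => //.
    exact: smooth_along_continuous sphi.
  apply: eq_bigr => a _; rewrite (radonZ radon_line_integral); last first.
    by apply: Cc_coord_average => //; exact: smooth_along_continuous sphi.
  by rewrite /term mulrA -exprMn mulN1r.
rewrite (real_dist_sum ru)// big1// => a _.
rewrite (real_distZ ru) ?u0 ?mulr0//.
apply/smooth_realE/smooth_alongM; last exact: smooth_coord_average.
by apply: smooth_alongX; exact: smooth_coordinate.
Qed.

Lemma coord_average_inv (i : 'I_n) c phi x s :
  coord_average i c phi (x + s *: delta_mx 0 i) = coord_average i c phi x.
Proof.
congr line_integral; apply/funext => t; congr (_ * phi _).
by apply/rowP => l; rewrite !mxE !eqxx /=; ring.
Qed.

(** Two applications of [coord_density], in the variables [x_i] and [x_j], reduce a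
    smooth function to monomials in these variables with coefficients that depend
    on the other ones only. *)
Lemma scalar_annihilated (i j : 'I_n) phi : i != j -> smooth_real phi -> u phi = 0.
Proof.
move=> ij /smooth_realE sphi; apply: (coord_density (i := i) sphi) => a c cc.
have sG := smooth_coord_average i cc sphi; set G := coord_average i c phi in sG *.
have sxG : smooth_along (fun=> True) (fun x : V => x 0 i ^+ a * G x).
  by apply: smooth_alongM => //; apply: smooth_alongX; exact: smooth_coordinate.
apply: (coord_density (i := j) sxG) => b c' cc'.
have -> : (fun x : V => x 0 j ^+ b * coord_average j c' (fun x : V => x 0 i ^+ a * G x) x) =
    fun x => x 0 i ^+ a * x 0 j ^+ b * coord_average j c' G x.
  apply/funext => x; rewrite [LHS]mulrC [RHS]mulrAC; congr (_ * _).
  rewrite /coord_average -(radonZ radon_line_integral); last first.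
    by apply: Cc_coord_average => //; exact: smooth_along_continuous sG.
  congr line_integral; apply/funext => s.
  have -> : set_coord j x s 0 i = x 0 i by rewrite !mxE (negbTE ij) /= mulr0 addr0.
  ring.
apply: (monomial_annihilated a b ij (smooth_coord_average j cc' sG)).
move=> x s t; rewrite addrA coord_average_inv; congr line_integral.
apply/funext => r; congr (_ * _); rewrite -[RHS](coord_average_inv i c phi _ s).
congr coord_average; apply/rowP => l; rewrite !mxE !eqxx [j == i]eq_sym (negbTE ij) /=; ring.
Qed.

End ScalarCase.

Lemma scalar_injectivity (R : realType) (n : nat) (u : ('rV[R]_n -> R) -> R) :
  (2 <= n)%N -> real_dist u ->
  (forall psi, ray_test psi -> u (ray_adjoint 0 (fun=> 1) psi) = 0) ->
  forall phi, smooth_real phi -> u phi = 0.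
Proof.
case: n u => [|[|n]]// u _ ru uI phi sphi.
apply: (scalar_annihilated ru _ (i := ord0) (j := lift ord0 ord0)) sphi => //.
by move=> a A xi sa aA; exact: (ray_average_annihilated ru uI sa aA).
Qed.

(** * Reduction of tensors to scalars *)

Section TensorReduction.
Context {R : realType} {n : nat}.
Notation V := 'rV[R]_n.
Notation e_ j := (delta_mx 0 j : V).

Lemma ray_functional_transl : transl_inv (@ray_functional R n).
Proof.
move=> [v t] f cf; rewrite /ray_functional.
have c2 xi : Cc (fun t => f (xi, t)).
  by apply: fiber_Cc_Cc; [exact: Cc_continuous|exact: Cc_fiber_Cc].
rewrite -[RHS](space_integral_transl v (Cc_radon_fiber radon_line_integral cf)).
congr space_integral; apply/funext => xi.
by rewrite -[RHS](line_integral_transl t (c2 (v + xi))).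
Qed.

Lemma ray_test_derive (psi : V * V -> R) v : ray_test psi -> ray_test ('D_v psi).
Proof.
case=> spsi [S [cS S0 Spsi]]; split; first exact: (smooth_along_derive _ spsi).
exists S; split=> // z nz.
have cl : closed S by apply: compact_closed cS; exact: norm_hausdorff.
have nb : nbhs z (~` S) by apply: open_nbhs_nbhs; split=> //; exact: closed_openC.
rewrite -[RHS](derive_cst (0 : R) z v); apply: near_eq_derive.
by move: nb; apply: filterS => y ny; exact: Spsi.
Qed.

Lemma ray_adjointD k (P Q : V -> R) psi x : continuous P -> continuous Q -> ray_test psi ->
  ray_adjoint k (fun xi => P xi + Q xi) psi x =
  ray_adjoint k P psi x + ray_adjoint k Q psi x.
Proof.
move=> cP cQ tpsi; rewrite /ray_adjoint -(radonD radon_ray_functional);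
  [|exact: Cc_ray_integrand..].
congr ray_functional; apply/funext => w; rewrite /ray_integrand; ring.
Qed.

(** Along a fixed line parameter [t], moving [xi] in the direction [v] moves
    [(x - t xi, xi)] in the direction [(- t v, v)]; integrating the resulting
    derivative over all [xi] gives [0]. *)
Lemma ray_adjoint_by_parts k (P : V -> R) psi (v x : V) : smooth_along (fun=> True) P ->
  ray_test psi ->
  ray_adjoint k ('D_v P) psi x =
  ray_adjoint k.+1 P ('D_(v, 0) psi) x - ray_adjoint k P ('D_(0, v) psi) x.
Proof.
move=> sP tpsi; have spsi := ray_test_smooth tpsi.
pose G (w : V * R) := ray_integrand k P psi (x, w).
have cP := smooth_along_continuous sP.
have sDP : smooth_along (fun=> True) ('D_v P) by exact: (smooth_along_derive _ sP).
have cDP := smooth_along_continuous sDP.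
have t1 := ray_test_derive (v, 0) tpsi; have t2 := ray_test_derive (0, v) tpsi.
have aff t : affine_along (fun xi : V => (x - t *: xi, xi)) v (- t *: v, v).
  move=> xi s; congr pair; rewrite /= scalerDr opprD addrCA scaleNr scalerN.
  by rewrite !scalerA [s * t]mulrC.
have dP xi : derivable P xi v by exact: smooth_along_derivable sP.
have dpsi z w : derivable psi z w by exact: smooth_along_derivable spsi.
have dcomp t xi : derivable (psi \o (fun xi : V => (x - t *: xi, xi))) xi v.
  by apply: derivable_comp_affine (aff t) _.
have dG xi t : is_derive xi v (fun xi => G (xi, t))
    (t ^+ k * ('D_v P xi * psi (x - t *: xi, xi) +
      P xi * (- t * 'D_(v, 0) psi (x - t *: xi, xi) + 'D_(0, v) psi (x - t *: xi, xi)))).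
  have -> : (fun xi => G (xi, t)) =
      (t ^+ k) *: (P * (psi \o (fun xi : V => (x - t *: xi, xi)))).
    by apply/funext => y; rewrite /G /ray_integrand /= -mulrA.
  apply: DeriveDef; first by apply: derivableZ; exact: derivableM.
  rewrite deriveZ; last exact: derivableM.
  rewrite deriveM// (derive_comp_affine _ _ (aff t)).
  have -> : (- t *: v, v) = - t *: (v, 0) + (0, v) :> V * V.
    by congr pair; rewrite /= ?scaler0 ?addr0 ?add0r.
  rewrite derive_dirD//; last first.
    have := smooth_along_continuous (smooth_along_derive (v := (0, v)) I spsi).
    exact.
  rewrite (derive_dirZ _ (dpsi _ _)) !scaleRE /=.
  set D1 := 'D_(v, 0) _ _; set D2 := 'D_(0, v) _ _; set D3 := 'D_v _ _; ring.
have DG w : 'D_(v, 0) G w = ray_integrand k ('D_v P) psi (x, w) -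
    ray_integrand k.+1 P ('D_(v, 0) psi) (x, w) + ray_integrand k P ('D_(0, v) psi) (x, w).
  case: w => xi t; rewrite derive_direction (@derive_val _ _ _ _ _ _ _ (dG xi t)).
  rewrite /ray_integrand /= exprS.
  set D1 := 'D_(v, 0) _ _; set D2 := 'D_(0, v) _ _; set D3 := 'D_v _ _; ring.
have cG : Cc G by exact: Cc_ray_integrand.
have cI1 : Cc (fun w => ray_integrand k ('D_v P) psi (x, w)) by exact: Cc_ray_integrand.
have cI2 : Cc (fun w => ray_integrand k.+1 P ('D_(v, 0) psi) (x, w)).
  exact: Cc_ray_integrand.
have cI3 : Cc (fun w => ray_integrand k P ('D_(0, v) psi) (x, w)).
  exact: Cc_ray_integrand.
have cI12 : Cc (fun w => ray_integrand k ('D_v P) psi (x, w) -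
    ray_integrand k.+1 P ('D_(v, 0) psi) (x, w)).
  exact: CcB cI1 cI2.
have JDG : ray_functional ('D_(v, 0) G) = 0.
  apply: (radon_derive_eq0 radon_ray_functional ray_functional_transl cG).
    by move=> [xi t]; apply: derivable_direction; case: (dG xi t).
  by rewrite (funext DG); exact: Cc_continuous (CcD cI12 cI3).
apply: subr0_eq; rewrite -[RHS]JDG (funext DG) opprB addrA addrAC.
by rewrite (radonD radon_ray_functional cI12 cI3) (radonB radon_ray_functional cI1 cI2).
Qed.

Definition dir_monomial (s : seq 'I_n) (xi : V) : R := \prod_(j <- s) xi 0 j.

Lemma smooth_dir_monomial s : smooth_along (fun=> True) (dir_monomial s).
Proof. by apply: smooth_along_prod => j; exact: smooth_coordinate. Qed.

Lemma dir_monomial_cons a s xi :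
  dir_monomial (a :: s) xi = xi 0 a * dir_monomial s xi.
Proof. by rewrite /dir_monomial big_cons. Qed.

Lemma derive_dir_monomial_nil v xi : 'D_v (dir_monomial [::]) xi = 0.
Proof.
have -> : dir_monomial [::] = cst 1 by apply/funext => y; rewrite /dir_monomial big_nil.
exact: derive_cst.
Qed.

Lemma derive_coordinate v a xi : 'D_v (fun xi : V => xi 0 a) xi = v 0 a.
Proof.
have aff : affine_along (fun xi : V => xi 0 a) v (v 0 a : R) by move=> y t; rewrite !mxE.
have := derive_comp_affine id xi aff; rewrite derive_id; exact.
Qed.

Lemma derive_dir_monomial_cons j a s xi :
  'D_(e_ j) (dir_monomial (a :: s)) xi =
  (a == j)%:R * dir_monomial s xi + xi 0 a * 'D_(e_ j) (dir_monomial s) xi.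
Proof.
have ca : derivable (fun xi : V => xi 0 a) xi (e_ j).
  exact: smooth_along_derivable (smooth_coordinate a).
have cs : derivable (dir_monomial s) xi (e_ j).
  exact: smooth_along_derivable (smooth_dir_monomial s).
have -> : dir_monomial (a :: s) = (fun xi : V => xi 0 a) * dir_monomial s.
  by apply/funext => y; rewrite dir_monomial_cons.
by rewrite (deriveM ca cs) derive_coordinate !scaleRE addrC mulrC mxE eqxx.
Qed.

Lemma sum_tuple_cons p (F : seq 'I_n -> R) :
  \sum_(i : p.+1.-tuple 'I_n) F i = \sum_a \sum_(i : p.-tuple 'I_n) F (a :: i).
Proof.
rewrite pair_big /= (reindex (fun z : 'I_n * p.-tuple 'I_n => [tuple of z.1 :: z.2])) //=.
exists (fun i : p.+1.-tuple 'I_n => (thead i, [tuple of behead i])) => [[a i] _|i _].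
  by congr pair; apply: val_inj.
by rewrite [RHS]tuple_eta; apply: val_inj.
Qed.

Definition additive_in_smooth (L : seq 'I_n -> (V -> R) -> R) :=
  forall s P Q, smooth_along (fun=> True) P -> smooth_along (fun=> True) Q ->
    L s (fun xi => P xi + Q xi) = L s P + L s Q.

Lemma additive_in_smooth0 L s : additive_in_smooth L -> L s (fun=> 0) = 0.
Proof.
move=> /(_ s _ _ (smooth_along_cst _ 0) (smooth_along_cst _ 0)).
under eq_fun do rewrite addr0; lra.
Qed.

(** Euler's relation for the differential of a symmetric form: each of the [p.+1]
    slots contributes the same sum once the matching index is moved in front. *)
Lemma symmetric_derivative_sum j p (L : seq 'I_n -> (V -> R) -> R) (w : V -> R) :
  additive_in_smooth L ->
  (forall s t P, smooth_along (fun=> True) P -> perm_eq s t -> L s P = L t P) ->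
  smooth_along (fun=> True) w ->
  \sum_(i : p.+1.-tuple 'I_n) L i (fun xi => w xi * 'D_(e_ j) (dir_monomial i) xi) =
  p.+1%:R * \sum_(i : p.-tuple 'I_n) L (j :: i) (fun xi => w xi * dir_monomial i xi).
Proof.
have smD s : smooth_along (fun=> True) ('D_(e_ j) (dir_monomial s)).
  exact: (smooth_along_derive _ (smooth_dir_monomial s)).
have sm := smooth_dir_monomial; have sc := @smooth_coordinate R n.
have split_cons L' w' a s : additive_in_smooth L' -> smooth_along (fun=> True) w' ->
    L' (a :: s) (fun xi => w' xi * 'D_(e_ j) (dir_monomial (a :: s)) xi) =
    (if a == j then L' (j :: s) (fun xi => w' xi * dir_monomial s xi) else 0) +
    L' (a :: s) (fun xi => (w' xi * xi 0 a) * 'D_(e_ j) (dir_monomial s) xi).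
  move=> Ladd sw.
  have -> : (fun xi => w' xi * 'D_(e_ j) (dir_monomial (a :: s)) xi) =
      fun xi => (a == j)%:R * (w' xi * dir_monomial s xi) +
                (w' xi * xi 0 a) * 'D_(e_ j) (dir_monomial s) xi.
    by apply/funext => xi; rewrite derive_dir_monomial_cons; ring.
  rewrite Ladd; first last.
  - exact: smooth_alongM (smooth_alongM sw (sc a)) (smD s).
  - exact: smooth_alongZ (smooth_alongM sw (sm s)).
  congr (_ + _); case: eqP => [->|_]; first by under eq_fun do rewrite mul1r.
  by under eq_fun do rewrite mul0r; exact: additive_in_smooth0.
elim: p L w => [|p IH] L w Ladd Lperm sw;
  rewrite (sum_tuple_cons _ (fun s => L s (fun xi => w xi * 'D_(e_ j) (dir_monomial s) xi)))
    exchange_big.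
- rewrite mul1r; apply: eq_bigr => i _.
  under eq_bigr do rewrite split_cons//.
  rewrite big_split /= -big_mkcond /= big_pred1_eq [X in _ + X]big1 ?addr0// => a _.
  rewrite tuple0 /=; under eq_fun do rewrite derive_dir_monomial_nil mulr0.
  exact: additive_in_smooth0.
- rewrite exchange_big /=.
  under eq_bigr => a _ do under eq_bigr => i _ do rewrite split_cons//.
  under eq_bigr do rewrite big_split /=.
  rewrite big_split /= exchange_big /=.
  under eq_bigr do rewrite -big_mkcond /= big_pred1_eq.
  rewrite -natr1 mulrDl mul1r addrC; congr (_ + _).
  rewrite (sum_tuple_cons _ (fun s => L (j :: s) (fun xi => w xi * dir_monomial s xi))).
  rewrite mulr_sumr; apply: eq_bigr => a _.
  rewrite (IH (fun s => L (a :: s))); first last.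
  + exact: smooth_alongM sw (sc a).
  + by move=> s t P sP st; apply: Lperm => //; rewrite perm_cons.
  + by move=> s; exact: Ladd.
  congr (_ * _); apply: eq_bigr => i _.
  have -> : (fun xi => w xi * dir_monomial (a :: i) xi) =
      fun xi => w xi * xi 0 a * dir_monomial i xi.
    by apply/funext => xi; rewrite dir_monomial_cons mulrA.
  apply: Lperm; first exact: smooth_alongM (smooth_alongM sw (sc a)) (sm i).
  by rewrite -[[:: a, j & i]]/([:: a] ++ [:: j] ++ i) perm_catCA.
Qed.

End TensorReduction.

Section TensorInjectivity.
Context {R : realType} {n : nat}.
Notation V := 'rV[R]_n.
Hypothesis n_ge2 : (2 <= n)%N.

Definition ray_transform m k (U : seq 'I_n -> (V -> R) -> R) (psi : V * V -> R) : R :=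
  \sum_(p < m.+1) \sum_(i : p.-tuple 'I_n) U i (ray_adjoint k (dir_monomial i) psi).

Lemma real_dist_scale c (u : (V -> R) -> R) : real_dist u ->
  real_dist (fun phi => c * u phi).
Proof.
move=> ru; split.
  by move=> a f g sf sg; rewrite (real_dist_linear ru)//; ring.
have [K [N [C [cK C0 ub]]]] := real_dist_bound ru.
exists K, N, (`|c| * C); split=> //; first exact: mulr_ge0.
by move=> f M sf M0 hM; rewrite normrM -mulrA ler_wpM2l//; exact: ub.
Qed.

Lemma real_dist_zero : real_dist (fun _ : V -> R => 0).
Proof.
split=> [a f g _ _|]; first by rewrite mulr0 addr0.
exists set0, 0%N, 0; split=> //; first exact: compact0.
by move=> f M _ _ _; rewrite normr0 mul0r.
Qed.

(** The identity [I^k U' = d_(xi_j) (I^k U) - d_(x_j) (I^(k+1) U)], read on test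
    functions, where both derivatives change sign. *)
Lemma ray_transform_contraction m k j U psi : (forall s, real_dist (U s)) ->
  (forall s t phi, perm_eq s t -> smooth_real phi -> U s phi = U t phi) ->
  ray_test psi ->
  ray_transform m k (fun s phi => (size s).+1%:R * U (j :: s) phi) psi =
  ray_transform m.+1 k.+1 U ('D_(delta_mx 0 j, 0) psi) -
  ray_transform m.+1 k U ('D_(0, delta_mx 0 j) psi).
Proof.
move=> rU permU tpsi.
have cm s := smooth_along_continuous (@smooth_dir_monomial R n s).
have t1 := ray_test_derive (delta_mx 0 j, 0) tpsi.
have t2 := ray_test_derive (0, delta_mx 0 j) tpsi.
rewrite /ray_transform -sumrB.
transitivity (\sum_(p < m.+2) \sum_(i : p.-tuple 'I_n)
    U i (ray_adjoint k (fun xi => 1 * 'D_(delta_mx 0 j) (dir_monomial i) xi) psi)).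
  rewrite [RHS]big_ord_recl /= [X in _ = X + _]big1 ?add0r; last first.
    move=> i _; rewrite -[RHS](real_dist0 (rU i)); congr (U i); apply/funext => x.
    rewrite -[RHS](radon0 (@radon_ray_functional R n)); congr ray_functional; apply/funext => w.
    by rewrite /ray_integrand tuple0 /= derive_dir_monomial_nil !mulr0 mul0r.
  apply: eq_bigr => p _; rewrite /bump /= add1n.
  pose L s w := U s (ray_adjoint k w psi).
  have := @symmetric_derivative_sum R n j p L (fun=> 1) _ _ (smooth_along_cst _ 1).
  rewrite /L => ->.
  - rewrite mulr_sumr; apply: eq_bigr => i _; rewrite size_tuple; congr (_ * U _ _).
    by congr ray_adjoint; apply/funext => xi; rewrite mul1r.
  - move=> s P Q sP sQ; rewrite -(real_distD (rU s)); first last.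
    + exact: (smooth_ray_adjoint k (smooth_along_continuous sQ) tpsi).
    + exact: (smooth_ray_adjoint k (smooth_along_continuous sP) tpsi).
    congr (U s); apply/funext => x; apply: ray_adjointD => //.
      exact: smooth_along_continuous sP.
    exact: smooth_along_continuous sQ.
  - move=> s t P sP st; apply: permU => //.
    exact: (smooth_ray_adjoint k (smooth_along_continuous sP) tpsi).
apply: eq_bigr => p _; rewrite -sumrB; apply: eq_bigr => i _.
have s1 := smooth_ray_adjoint k.+1 (cm i) t1.
have s2 := smooth_ray_adjoint k (cm i) t2.
have := real_dist_linear (rU i) (-1) s2 s1; rewrite mulN1r addrC => <-.
congr (U i); apply/funext => x.
transitivity (ray_adjoint k ('D_(delta_mx 0 j) (dir_monomial i)) psi x).
  by congr (ray_adjoint _ _ _ _); apply/funext => xi; rewrite mul1r.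
rewrite (ray_adjoint_by_parts _ _ _ (@smooth_dir_monomial R n i) tpsi).
by rewrite mulN1r addrC.
Qed.

(** By induction all components of positive rank vanish, because they are
    components of contractions; what is left of the moment [0] is the ray
    transform of the component of rank [0]. *)
Lemma tensor_injectivity m (U : seq 'I_n -> (V -> R) -> R) :
  (forall s, real_dist (U s)) ->
  (forall s t phi, perm_eq s t -> smooth_real phi -> U s phi = U t phi) ->
  (forall k, (k <= m)%N -> forall psi, ray_test psi -> ray_transform m k U psi = 0) ->
  forall s, (size s <= m)%N -> forall phi, smooth_real phi -> U s phi = 0.
Proof.
have scalar (U' : seq 'I_n -> (V -> R) -> R) : real_dist (U' [::]) ->
    (forall psi, ray_test psi ->
       \sum_(i : 0.-tuple 'I_n) U' i (ray_adjoint 0 (dir_monomial i) psi) = 0) ->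
    forall phi, smooth_real phi -> U' [::] phi = 0.
  move=> rU I0; apply: (scalar_injectivity n_ge2 rU) => psi tpsi.
  rewrite -[RHS](I0 psi tpsi) (big_pred1 [tuple]) => [|i]; last first.
    by apply/esym/eqP; rewrite [LHS]tuple0.
  congr (U' _ _); congr ray_adjoint; apply/funext => xi.
  by rewrite /dir_monomial big_nil.
elim: m U => [|m IH] U rU permU I0 s.
  rewrite leqn0 size_eq0 => /eqP -> phi; apply: scalar => // psi tpsi.
  by have := I0 0%N (leqnn _) psi tpsi; rewrite /ray_transform big_ord1.
have tail j t : (size t <= m)%N -> forall phi, smooth_real phi -> U (j :: t) phi = 0.
  move=> tm phi sphi.
  have /eqP : (size t).+1%:R * U (j :: t) phi = 0; last first.
    by rewrite mulf_eq0 pnatr_eq0 /= => /eqP.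
  apply: (IH (fun s phi => (size s).+1%:R * U (j :: s) phi)) => //.
  - by move=> r; exact: real_dist_scale.
  - move=> r r' f rr' sf; rewrite (perm_size rr'); congr (_ * _).
    by apply: permU => //; rewrite perm_cons.
  - move=> k km psi tpsi; rewrite ray_transform_contraction//.
    have t1 := ray_test_derive (delta_mx 0 j, 0) tpsi.
    have t2 := ray_test_derive (0, delta_mx 0 j) tpsi.
    by rewrite (I0 k.+1 km _ t1) (I0 k (leqW km) _ t2) subrr.
case: s => [_ phi|j t]; last exact: tail.
apply: scalar => // psi tpsi; have := I0 0%N (leq0n _) psi tpsi.
rewrite /ray_transform big_ord_recl /= [X in _ + X]big1 ?addr0// => p _.
apply: big1 => -[[|j t] //= /eqP tp] _; apply: tail.
  by rewrite -ltnS -ltnS tp; exact: (ltn_ord (lift ord0 p)).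
exact: (smooth_ray_adjoint 0 (smooth_along_continuous (smooth_dir_monomial _)) tpsi).
Qed.

End TensorInjectivity.

(** * Complex-valued distributions *)

Section RealParts.
Context {R : realType}.
Local Open Scope complex_scope.

Lemma integral_R_real (f : R -> R) :
  integral_R (fun t => (f t)%:C) = (line_integral f)%:C.
Proof.
rewrite /integral_R /=; congr (_ +i* _).
by rewrite Rintegral_cst// mul0r.
Qed.

Lemma integral_Rn_real n (f : 'rV[R]_n -> R) :
  integral_Rn (fun x => (f x)%:C) = (space_integral f)%:C.
Proof.
elim: n f => [//|n IH] f /=; rewrite -integral_R_real; congr integral_R.
by apply/funext => t; rewrite IH.
Qed.

Lemma mrt_adjoint_real n k p (i : p.-tuple 'I_n) (psi : 'rV[R]_n * 'rV[R]_n -> R) x :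
  mrt_adjoint k i (fun z => (psi z)%:C) x = (ray_adjoint k (dir_monomial i) psi x)%:C.
Proof.
rewrite /mrt_adjoint -integral_Rn_real; congr integral_Rn; apply/funext => xi.
rewrite -integral_R_real; congr integral_R; apply/funext => t.
rewrite -rmorphM; congr (_%:C); congr (_ * _ * _).
by rewrite /dir_monomial big_tuple.
Qed.

Lemma smooth_complexify (V : normedModType R) (f : V -> R) : smooth_real f ->
  smooth (fun x => (f x)%:C).
Proof. by move=> sf; split; [exact: sf|apply/smooth_realE; exact: smooth_along_cst]. Qed.

Lemma test_function_complexify n (psi : 'rV[R]_n * 'rV[R]_n -> R) :
  ray_test psi -> test_function (fun z => (psi z)%:C).
Proof.
case=> spsi [S [cS S0 Spsi]].
have cl : closed S by apply: compact_closed cS; exact: norm_hausdorff.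
have sub : closure [set z | (psi z)%:C != 0] `<=` S.
  rewrite [X in _ `<=` X](closure_id S).1//; apply: closure_subset => z /= pz.
  by apply: contrapT => /Spsi E; move: pz; rewrite E eqxx.
split.
- exact/smooth_complexify/smooth_realE.
- by apply: subclosed_compact sub => //; exact: closed_closure.
- by move=> z /sub; exact: S0.
Qed.

Section Part.
Variable part : R[i] -> R.
Hypothesis part_linear : forall a z w, part (a%:C * z + w) = a * part z + part w.
Hypothesis part_le : forall z, (`|part z|)%:C <= `|z|.

Let part0 : part 0 = 0.
Proof. by have := part_linear 1 0 0; rewrite mulr0 addr0; lra. Qed.

Let part_sum I (s : seq I) (F : I -> R[i]) :
  part (\sum_(i <- s) F i) = \sum_(i <- s) part (F i).
Proof.
elim: s => [|i s IH]; first by rewrite !big_nil.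
by rewrite !big_cons -IH -[F i in LHS]mul1r part_linear mul1r.
Qed.

Lemma real_dist_part n (f : cs_distribution R n) :
  real_dist (fun phi => part (f (fun x => (phi x)%:C))).
Proof.
split.
- move=> a phi chi sphi schi; rewrite -part_linear -dist_linear;
    [|exact: smooth_complexify..].
  by congr (part (f _)); apply/funext => x; rewrite rmorphD rmorphM.
- have [K [N [c [cK ub]]]] := dist_continuous f.
  exists K, N, `|c|; split=> // phi M sphi M0 hM.
  rewrite -lecR; apply: le_trans (part_le _) _.
  apply: (@le_trans _ _ (c * M)%:C); last by rewrite lecR ler_wpM2r// ler_norm.
  apply: (ub _ _ (smooth_complexify sphi) M0) => alpha Na x Kx.
  rewrite /partial /= iter_deriv0.
  rewrite normc_def /= expr0n addr0 sqrtr_sqr lecR; exact: hM.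
Qed.

(** Indexing by all sequences, with the value [0] where [F] has no component, frees
    the components from a type that depends on their rank. *)
Definition component_part n m (F : sym_tensor_sum R n m) (s : seq 'I_n)
    (phi : 'rV[R]_n -> R) : R :=
  if insub (size s) is Some p then
    if insub s is Some i then part (F p i (fun x => (phi x)%:C)) else 0
  else 0.

Lemma component_part_tuple n m (F : sym_tensor_sum R n m) (p : 'I_m.+1)
    (i : p.-tuple 'I_n) phi :
  component_part F i phi = part (F p i (fun x => (phi x)%:C)).
Proof. by rewrite /component_part size_tuple valK valK. Qed.

Lemma component_part_eq0 n m (F : sym_tensor_sum R n m) : (2 <= n)%N ->
  (forall k : nat, (k <= m)%N -> forall psi, test_function psi -> gmrt k F psi = 0) ->
  forall (p : 'I_m.+1) (i : p.-tuple 'I_n) phi, smooth_real phi ->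
  part (F p i (fun x => (phi x)%:C)) = 0.
Proof.
move=> n2 F0 p i phi sphi; rewrite -component_part_tuple.
apply: (@tensor_injectivity R n n2 m) => //; last by rewrite size_tuple -ltnS.
- move=> s; rewrite /component_part; case: insubP => [q _ _|_].
    case: insubP => [t _ _|_]; first exact: real_dist_part.
    exact: real_dist_zero.
  exact: real_dist_zero.
- move=> s t f st sf; rewrite /component_part -(perm_size st).
  case: insubP => [q _ qs|//]; case: insubP => [s' _ s'E|/eqP[]]; last by rewrite qs.
    case: insubP => [t' _ t'E|/eqP[]]; last by rewrite -(perm_size st) qs.
    have /tuple_permP[g gE] : perm_eq t' s' by rewrite s'E t'E perm_sym.
    have -> : t' = [tuple tnth s' (g j) | j < q] by apply: val_inj.
    by rewrite (tens_sym (F q) g s' (smooth_complexify sf)).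
- move=> k km psi tpsi; rewrite /ray_transform.
  have := congr1 part (F0 k km _ (test_function_complexify tpsi)).
  rewrite part0 /gmrt part_sum => E; rewrite -[RHS]E; apply: eq_bigr => q _.
  rewrite /mrt part_sum; apply: eq_bigr => t _.
  rewrite component_part_tuple; congr (part (F q t _)).
  by apply/funext => x; rewrite mrt_adjoint_real.
Qed.

End Part.
End RealParts.

Theorem theorem4p5 (R : realType) (n m : nat) (F : sym_tensor_sum R n m) :
  (2 <= n)%N ->
  (forall k : nat, (k <= m)%N ->
     forall psi : 'rV[R]_n * 'rV[R]_n -> R[i],
       test_function psi -> gmrt k F psi = 0%R) ->
  sym_tensor_sum_eq0 F.
Proof.
move=> n2 F0 p i phi [sre sim].
have Re0 f (sf : smooth_real f) : complex.Re (F p i (fun x => (f x)%:C)%C) = 0.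
  apply: (@component_part_eq0 R (@complex.Re R)) => //.
  - by move=> a [z1 z2] [w1 w2] /=; rewrite mul0r subr0.
  - exact: normc_ge_Re.
have Im0 f (sf : smooth_real f) : complex.Im (F p i (fun x => (f x)%:C)%C) = 0.
  apply: (@component_part_eq0 R (@complex.Im R)) => //.
  - by move=> a [z1 z2] [w1 w2] /=; rewrite mul0r addr0.
  - move=> z; have := normc_ge_Re (z * 'i%C).
    rewrite ReiNIm normrN normrM; congr (_ <= _).
    by rewrite [`|'i%C|]normc_def /= expr0n expr1n add0r sqrtr1 mulr1.
have F00 f : smooth_real f -> F p i (fun x => (f x)%:C)%C = 0.
  by move=> sf; apply/eqP; rewrite eq_complex Re0// Im0// !eqxx.
have -> : phi = fun x => 'i%C * (complex.Im (phi x))%:C%C + (complex.Re (phi x))%:C%C.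
  by apply/funext => x; rewrite addrC; exact: complexE.
by rewrite dist_linear; [rewrite !F00// mulr0 addr0|exact: smooth_complexify..].
Qed.
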